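(* Let $n\ge3$ and let $M=\begin{pmatrix} x_1 & x_2 & \cdots & x_n\\ y_1 & y_2 & \cdots & y_n\end{pmatrix}$ be a $2\times n$ integer 1-prime matrix with $Y_{ij}:=x_iy_j-x_jy_i>0$ for all $1\le i<j\le n$. Let $1\le k\le n-1$ and $\mathbf n=(n_1,n_2)^T\in\Omega_k\cap\mathbb Z^2$. Then $$t(\mathbf n|M)=p_{e,\Omega_k}(\mathbf n)+\sum_{(i,j):\ i\le k<j}\sigma_{t_{ij}}(C_{ij};Y_{ij}),$$ where $p_{e,\Omega_k}(\mathbf x)=\sum_{j=0}^{n-2}p_{j,\Omega_k}(\mathbf x)$ with, for $\mathbf x=(x,y)^T$, $$p_{0,\Omega_k}(\mathbf x)=\frac{1}{(n-2)!}\sum_{l=k+1}^n\frac{(y_lx-x_ly)^{n-2}}{\prod_{j\ne l}(y_lx_j-y_jx_l)},$$ $$p_{j,\Omega_k}(\mathbf x)=-\sum_{l=0}^{j-1}\Bigl(\sum_{|v|=j-l}D^vp_{l,\Omega_k}(\mathbf x)\,(-\mathrm i)^{|v|}\frac{D^v\widehat B(0|M)}{v!}\Bigr)\quad (j\ge1),$$ and, for each pair $i<j$, with any choice of an index $m\in\{1,\dots,n\}\setminus\{i,j\}$, integers $f,g$ with $\gcd(fY_{im}+gY_{jm},Y_{ij})=1$, and an integer $(fY_{im}+gY_{jm})^{-1}$ inverse to $fY_{im}+gY_{jm}$ modulo $Y_{ij}$ (all depending on $(i,j)$), $C_{ij}$ is the multiset of the $n-2$ integers $$(fY_{im}+gY_{jm})^{-1}\bigl(-(fy_i+gy_j)x_h+(fx_i+gx_j)y_h\bigr),\qquad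 1\le h\le n,\ h\ne i,j,$$ and $$t_{ij}=(fY_{im}+gY_{jm})^{-1}\bigl(-(fy_i+gy_j)n_1+(fx_i+gx_j)n_2\bigr)+\sum_{c\in C_{ij}}c.$$
   Context: For an integer $2\times n$ matrix $M$, $t(\mathbf b|M)=\#\{\mathbf x\in\mathbb Z_{\ge0}^n: M\mathbf x=\mathbf b\}$. $Y_{ab}=x_ay_b-x_by_a$ for all indices $a,b$. The condition $Y_{ij}>0$ for $i<j$ expresses that the columns are ordered by increasing slope (when all $x_i>0$ it reads $\frac{y_i}{x_i}<\frac{y_{i+1}}{x_{i+1}}$), and it implies that the convex hull of the columns does not contain the origin. A $2\times n$ integer matrix is 1-prime if for every choice of three of its columns spanning $\mathbb R^2$, the gcd of the absolute values of the nonzero $2\times2$ minors formed from these columns is $1$. $\Omega_k$ is the open cone $\{a(x_k,y_k)^T+b(x_{k+1},y_{k+1})^T: a,b>0\}$. The Fourier–Dedekind sum is, for a positive integer $N$, a finite multiset $C$ of integers, and an integer $t$, $\sigma_t(C;N)=\frac1N\sum_{\lambda^N=1,\ \lambda\ne1}\frac{\lambda^t}{\prod_{c\in C}(\lambda^c-1)}$ (sum over complex $N$-th roots of unity $\lambda\neq 1$; it is $0$ if $N=1$). $\mathrm i=\sqrt{-1}$. For $v=(v_1,v_2)\in\mathbb Z_{\ge0}^2$, $|v|=v_1+v_2$, $v!=v_1!v_2!$, $D^v=\partial_1^{v_1}\partial_2^{v_2}$. $\widehat B(\zeta|M)=\prod_{j=1}^n\frac{1-\exp(-\mathrm i\zeta^Tm_j)}{\mathrm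 i\zeta^Tm_j}$, $\zeta\in\mathbb C^2$, where $m_j=(x_j,y_j)^T$ is the $j$-th column of $M$ (extended analytically through $\zeta^Tm_j=0$). *)

(* Defs.v *)
(* Columns are indexed by 'I_n, hence from 0. *)
From HB Require Import structures.
From mathcomp Require Import all_boot all_order all_algebra.
From mathcomp Require Import complex.
From mathcomp Require Import finmap.
From mathcomp Require Import all_classical all_reals all_analysis.

Set Implicit Arguments.
Unset Strict Implicit.
Unset Printing Implicit Defensive.

Import Order.TTheory GRing.Theory Num.Theory numFieldNormedType.Exports.

Local Open Scope classical_set_scope.
Local Open Scope ring_scope.

(* Number of nonnegative integer solutions of M x = b.  [fset_set] sends an
   infinite set to the empty one; the solution set is finite as soon as the
   convex hull of the columns of M avoids the origin. *)
Definition vpart n (M : 'M[int]_(2, n)) (b : 'cV[int]_2) : nat :=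
  #|` fset_set [set x : 'cV[nat]_n | M *m map_mx Posz x = b] |.

Definition minor2 n (M : 'M[int]_(2, n)) (a b : 'I_n) : int :=
  M 0 a * M 1 b - M 0 b * M 1 a.

Definition one_prime (R : realType) n (M : 'M[int]_(2, n)) : Prop :=
  forall s : 'I_3 -> 'I_n, injective s ->
    \rank (map_mx intr (colsub s M) : 'M[R]_(2, 3)) = 2%N ->
    \big[gcdn/0%N]_(p : 'I_3 * 'I_3 |
        (p.1 < p.2)%N && (minor2 M (s p.1) (s p.2) != 0))
      `|minor2 M (s p.1) (s p.2)|%N = 1%N.

Definition open_cone (R : realType) n (M : 'M[int]_(2, n)) (i j : 'I_n) :
    set 'cV[R]_2 :=
  [set v | exists a b : R, [/\ 0 < a, 0 < b &
    v = a *: map_mx intr (col i M) + b *: map_mx intr (col j M)]].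

Definition fourier_dedekind (R : realType) (t : int) (C : seq int) (N : nat) :
    R[i] :=
  N%:R^-1 * \sum_(l \in [set l : R[i] | l ^+ N = 1 /\ l != 1])
              (l ^ t / \prod_(c <- C) (l ^ c - 1)).

Definition cexp (R : realType) (z : R[i]) : R[i] :=
  let: (a +i* b)%C := z in (expR a * cos b +i* (expR a * sin b))%C.

(* The codomain R[i]^o makes the derivatives below complex derivatives. *)
Definition partialD (R : realType) (i : 'I_2) (f : 'cV[R[i]]_2 -> R[i]^o) :
    'cV[R[i]]_2 -> R[i]^o :=
  fun z => 'D_(delta_mx i 0) f z.

Definition multiD (R : realType) (v : nat * nat) (f : 'cV[R[i]]_2 -> R[i]^o) :
    'cV[R[i]]_2 -> R[i]^o :=
  iter v.1 (partialD 0) (iter v.2 (partialD 1) f).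

(* (1 - exp (- i s)) / (i s), with its removable singularity at s = 0 filled. *)
Definition Bfactor (R : realType) (s : R[i]) : R[i] :=
  if s == 0 then 1 else (1 - cexp (- ('i%C * s))) / ('i%C * s).

Definition Bhat (R : realType) n (M : 'M[int]_(2, n)) (z : 'cV[R[i]]_2) :
    R[i]^o :=
  \prod_(j < n) Bfactor ((z^T *m map_mx intr (col j M)) 0 0).

(* The polynomials p_j, as functions on C^2, for the cone spanned by the
   columns k and k + 1. *)
Section Polynomials.
Variables (R : realType) (n : nat) (M : 'M[int]_(2, n)) (k : 'I_n).

Definition p_zero (z : 'cV[R[i]]_2) : R[i]^o :=
  ((n - 2)`!)%N%:R^-1 *
  \sum_(l < n | (k < l)%N)
    ((M 1 l)%:~R * z 0 0 - (M 0 l)%:~R * z 1 0) ^+ (n - 2)%N /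
    \prod_(j < n | j != l) (M 1 l * M 0 j - M 1 j * M 0 l)%:~R.

Definition p_step (q : nat -> 'cV[R[i]]_2 -> R[i]^o) (j : nat)
    (z : 'cV[R[i]]_2) : R[i]^o :=
  - \sum_(l < j) \sum_(v : 'I_j.+1 * 'I_j.+1 | (v.1 + v.2 == j - l)%N)
      multiD (v.1 : nat, v.2 : nat) (q l) z * (- 'i%C) ^+ (v.1 + v.2)%N *
      (multiD (v.1 : nat, v.2 : nat) (@Bhat R n M) 0 / (v.1`! * v.2`!)%N%:R).

(* [:: p_0; ...; p_j] *)
Fixpoint p_list (j : nat) : seq ('cV[R[i]]_2 -> R[i]^o) :=
  if j is j'.+1 then
    rcons (p_list j') (p_step (nth (fun=> 0) (p_list j')) j)
  else [:: p_zero].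

Definition p_ (j : nat) : 'cV[R[i]]_2 -> R[i]^o := nth (fun=> 0) (p_list j) j.

Lemma size_p_list j : size (p_list j) = j.+1.
Proof. by elim: j => //= j IHj; rewrite size_rcons IHj. Qed.

Lemma nth_p_list j l : (l <= j)%N -> nth (fun=> 0) (p_list j) l = p_ l.
Proof.
elim: j => [|j IHj]; first by rewrite leqn0 => /eqP ->.
rewrite leq_eqVlt ltnS => /orP[/eqP -> // | lej].
by rewrite /= nth_rcons size_p_list ltnS lej IHj.
Qed.

Lemma p_0E : p_ 0 = p_zero.
Proof. by []. Qed.

Lemma p_recE j : (0 < j)%N -> p_ j = p_step p_ j.
Proof.
case: j => // j _; rewrite {1}/p_ /= nth_rcons size_p_list ltnn eqxx.
apply/funext => z; rewrite /p_step; congr (- _).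
apply: eq_bigr => l _; apply: eq_bigr => v _.
by rewrite nth_p_list // -ltnS.
Qed.

Definition p_e (z : 'cV[R[i]]_2) : R[i] := \sum_(j < (n - 2).+1) p_ j z.

End Polynomials.

(* w stands for the chosen inverse of f * Y_im + g * Y_jm modulo Y_ij. *)
Definition fd_coef n (M : 'M[int]_(2, n)) (i j : 'I_n) (f g w : int)
    (u : 'cV[int]_2) : int :=
  w * (- (f * M 1 i + g * M 1 j) * u 0 0 + (f * M 0 i + g * M 0 j) * u 1 0).

Definition fd_C n (M : 'M[int]_(2, n)) (i j : 'I_n) (f g w : int) : seq int :=
  [seq fd_coef M i j f g w (col h M) | h <- enum 'I_n & (h != i) && (h != j)].

Definition fd_t n (M : 'M[int]_(2, n)) (i j : 'I_n) (f g w : int)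
    (b : 'cV[int]_2) : int :=
  fd_coef M i j f g w b + \sum_(c <- fd_C M i j f g w) c.

(* Main.v *)
(* Deform the count by weighting a solution x with exp(t s.x), for generic real
   slopes s and t > 0. The poles z^(m_i) = exp(t s_i), z^(m_j) = exp(t s_j) of the
   generating function are then simple, and for b in Omega_k the weighted count is
   a sum over i <= k < j and over the Y_ij characters chi of Z^2 with
   chi(m_i) = exp(t s_i) and chi(m_j) = exp(t s_j). This is proved by induction on
   the set of columns: the difference f of the two sides satisfies
   f(b) = exp(t s_h) f(b - m_h) for every column m_h, and a linear relation between
   three columns, together with genericity, forces f = 0.
   Now let t tend to 0. The characters whose value at t = 0 is nontrivial
   contribute the Fourier-Dedekind sums. For each pair (i, j) the remaining
   character is singular, of order n - 2; Lagrange interpolation along the lines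
   {w : w.m_l = s_l}, l > k, shows that the singular parts cancel and identifies
   the limit with the Todd operator applied to p_0, which is also what the
   recursion for the p_j computes, once the derivatives of the analytic function
   Bhat at 0 have been replaced by coefficients of formal power series. *)
Require Import Defs.
From HB Require Import structures.
From mathcomp Require Import all_boot all_order all_algebra.
From mathcomp Require Import complex.
From mathcomp Require Import finmap.
From mathcomp Require Import all_classical all_reals all_analysis.
From mathcomp Require Import ring zify.
From mathcomp Require cyclic separable cyclotomic.
Import Order.TTheory GRing.Theory Num.Theory numFieldNormedType.Exports.
Local Open Scope classical_set_scope.
Local Open Scope ring_scope.
Set Implicit Arguments.
Unset Strict Implicit.
Unset Printing Implicit Defensive.

(** * Weighted counting of lattice points *)

(** The undeformed generating function cannot be treated pair by pair: at the trivial character all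
    n factors vanish together, and no residue belongs to a single pair (i, j). Taking the slopes s
    real makes genericity independent of the characters. Roots of unity have modulus 1, so a
    coincidence chi(m_h) = exp(t s_h) already forces w_ij(m_h) = s_h, where w_ij is the linear form
    with w_ij(m_i) = s_i and w_ij(m_j) = s_j; hence one choice of s serves every t > 0 and every
    character. One-primality keeps the other characters harmless as t tends to 0: a nontrivial
    character of Z^2 / (Z m_i + Z m_j) differs from 1 on every third column. No Laurent series is
    needed for the singular characters: their contributions are t^-(n-2) times functions regular at
    0, so polynomials modulo t^(n-1) suffice. *)

Definition det2 (u v : 'cV[int]_2) : int := u 0 0 * v 1 0 - v 0 0 * u 1 0.

Lemma det2Dl u v w : det2 (u + v) w = det2 u w + det2 v w.
Proof. by rewrite /det2 !mxE; ring. Qed.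

Lemma det2Dr u v w : det2 u (v + w) = det2 u v + det2 u w.
Proof. by rewrite /det2 !mxE; ring. Qed.

Lemma det2Zl c u v : det2 (c *: u) v = c * det2 u v.
Proof. by rewrite /det2 !mxE; ring. Qed.

Lemma det2Zr c u v : det2 u (c *: v) = c * det2 u v.
Proof. by rewrite /det2 !mxE; ring. Qed.

Lemma det2C u v : det2 v u = - det2 u v.
Proof. by rewrite /det2; ring. Qed.

Lemma det2uu u : det2 u u = 0.
Proof. by rewrite /det2; ring. Qed.

Lemma det2_plucker (u v w x : 'cV[int]_2) :
  det2 u w * det2 v x - det2 v w * det2 u x = det2 u v * det2 w x.
Proof. by rewrite /det2; ring. Qed.

Lemma cV2P (T : Type) (u v : 'cV[T]_2) :
  u 0 0 = v 0 0 -> u 1 0 = v 1 0 -> u = v.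
Proof.
move=> uv0 uv1; apply/matrixP => i j; rewrite ord1.
case: i => [[|[|//]] ilt].
  by rewrite (_ : Ordinal ilt = 0) //; apply: val_inj.
by rewrite (_ : Ordinal ilt = 1) //; apply: val_inj.
Qed.

Lemma det2_basis (u v x : 'cV[int]_2) :
  det2 u v *: x = det2 x v *: u + det2 u x *: v.
Proof. by apply: cV2P; rewrite !mxE /det2; ring. Qed.

Section Solutions.
Variables (n : nat) (M : 'M[int]_(2, n)).
Implicit Types (S : {set 'I_n}) (b : 'cV[int]_2) (x : 'cV[nat]_n).

Lemma minor2E i j : minor2 M i j = det2 (col i M) (col j M).
Proof. by rewrite /minor2 /det2 !mxE. Qed.

(** Columns are removed by restricting the support to [S], so the matrix and the index type stay
    fixed during the induction on the set of columns. *)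
Definition sols S b : set 'cV[nat]_n :=
  [set x | M *m map_mx Posz x = b /\ forall j, j \notin S -> x j 0 = 0%N].

Lemma mulmx_sumcol x :
  M *m map_mx Posz x = \sum_j (x j 0)%:Z *: col j M.
Proof.
apply/matrixP => i j; rewrite ord1 mxE summxE; apply: eq_bigr => l _.
by rewrite !mxE mulrC.
Qed.

Lemma det2_sumr u (F : 'I_n -> 'cV[int]_2) :
  det2 u (\sum_j F j) = \sum_j det2 u (F j).
Proof.
apply: (big_morph (det2 u)) => [v w|]; first exact: det2Dr.
by rewrite /det2 !mxE; ring.
Qed.

Lemma det2_sols S b u x : sols S b x ->
  det2 u b = \sum_(j in S) (x j 0)%:Z * det2 u (col j M).
Proof.
case=> <- xS; rewrite mulmx_sumcol det2_sumr [RHS]big_mkcond.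
apply: eq_bigr => j _; rewrite det2Zr; case: ifPn => // jS.
by rewrite xS // mul0r.
Qed.

Hypothesis hn : (1 < n)%N.
Hypothesis hY : forall i j : 'I_n, (i < j)%N -> 0 < minor2 M i j.

Lemma minor2_ge0 (i j : 'I_n) : (i <= j)%N -> 0 <= minor2 M i j.
Proof.
rewrite leq_eqVlt => /orP[/eqP/val_inj -> | /hY/ltW //].
by rewrite minor2E det2uu.
Qed.

Let i0 : 'I_n := Ordinal (ltnW hn).
Fact pred_lt_subproof : (n.-1 < n)%N. Proof. by rewrite ltn_predL ltnW. Qed.
Let il : 'I_n := Ordinal pred_lt_subproof.

(** The linear form det2 (m_first - m_last, .) is a positive integer on every column, so its value
    at b bounds each coordinate of a solution. *)
Lemma sols_bounded S b x j : sols S b x ->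
  (x j 0%R <= `|det2 (col i0 M) b - det2 (col il M) b|)%N.
Proof.
move=> [xb xS].
have sx : sols [set: 'I_n]%SET b x by split=> // i; rewrite inE.
rewrite !(det2_sols _ sx) -sumrB.
have Hpos (h : 'I_n) : 1 <= minor2 M i0 h - minor2 M il h.
  have A : 0 <= minor2 M i0 h by exact: minor2_ge0.
  have hl : (h <= il)%N by rewrite -ltnS prednK // ltnW.
  have B : 0 <= minor2 M h il by exact: minor2_ge0.
  have C : minor2 M il h = - minor2 M h il by rewrite !minor2E det2C.
  have [h0|h0] := eqVneq (nat_of_ord h) 0%N.
    have : 0 < minor2 M h il.
      by apply: hY; rewrite h0 /= -subn1 subn_gt0.
    by lia.
  have : 0 < minor2 M i0 h by apply: hY; rewrite /= lt0n.
  by lia.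
have H : (x j 0)%:Z <= \sum_(i in [set: 'I_n]%SET)
  ((x i 0)%:Z * det2 (col i0 M) (col i M) - (x i 0)%:Z * det2 (col il M) (col i M)).
  rewrite (bigD1 j) ?inE //=.
  have := Hpos j; rewrite !minor2E => Hj.
  apply: le_trans (_ : _ <= (x j 0)%:Z * det2 (col i0 M) (col j M) - (x j 0)%:Z *
    det2 (col il M) (col j M)) _.
    by rewrite -mulrBr ler_peMr.
  rewrite lerDl; apply: sumr_ge0 => i _; rewrite -mulrBr mulr_ge0 //.
  by have := Hpos i; rewrite !minor2E; lia.
by rewrite -lez_nat abszE (le_trans H) // ler_norm.
Qed.

Lemma finite_sols S b : finite_set (sols S b).
Proof.
set B := `|det2 (col i0 M) b - det2 (col il M) b|%N.
apply: (@sub_finite_set _ _ [set map_mx val y | y in [set: 'cV['I_B.+1]_n]]).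
  move=> x xs; exists (map_mx inord x) => //; apply/matrixP => i j.
  by rewrite !mxE /= inordK // ltnS ord1; apply: sols_bounded xs.
exact: finite_image.
Qed.

Variables (K : fieldType) (a : 'I_n -> K).

Definition wsum S b : K := \sum_(x \in sols S b) \prod_j a j ^+ x j 0.

(** This is multiplication of the generating function by 1 - a_h z^(m_h): the solutions with x_h = 0
    form the first term, and lowering x_h by one turns the others into solutions for b - m_h. *)
Lemma wsum_rec S b h : h \in S ->
  wsum S b = wsum (S :\ h) b + a h * wsum S (b - col h M).
Proof.
move=> hS; rewrite /wsum (fsbigID [set x : 'cV[nat]_n | x h 0 = 0%N]); last first.
  exact: (sub_finite_set _ (finite_sols S b)) => x [].
congr (_ + _).
  apply: eq_fsbigl; apply/seteqP; split=> x /=.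
    move=> [[xb xS] xh]; split=> // j; rewrite !inE negb_and negbK.
    by case/orP => [/eqP -> //|]; exact: xS.
  move=> [xb xS]; split; last by apply: xS; rewrite !inE eqxx.
  by split=> // j jS; apply: xS; rewrite !inE negb_and jS orbT.
pose g x : 'cV[nat]_n := \col_j (x j 0%R + (j == h))%N.
have gE x : map_mx Posz (g x) = map_mx Posz x + delta_mx h 0 :> 'cV_n.
  by apply/matrixP => i j; rewrite !mxE ord1 eqxx andbT PoszD; case: (i == h).
have Mg x : M *m map_mx Posz (g x) = M *m map_mx Posz x + col h M.
  by rewrite gE mulmxDr colE.
rewrite mulr_fsumr.
rewrite (@reindex_fsbig _ _ _ _ _ g (sols S (b - col h M))); last first.
  split.
  - move=> x [xb xS]; split; last by rewrite /= mxE eqxx addn1.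
    split; first by rewrite Mg xb subrK.
    move=> j jS; rewrite mxE xS //; case: eqVneq jS => [->|//].
    by rewrite hS.
  - move=> x y _ _ /matrixP gxy; apply/matrixP => i j; rewrite ord1.
    by have := gxy i 0; rewrite !mxE => /addIn.
  - move=> x [[xb xS] xh].
    exists (\col_j (x j 0%R - (j == h))%N); last first.
      apply/matrixP => i j; rewrite ord1 !mxE subnK //.
      by case: eqVneq => [->|//]; rewrite lt0n; apply/eqP.
    have gx : g (\col_j (x j 0%R - (j == h))%N) = x.
      apply/matrixP => i j; rewrite ord1 !mxE subnK //.
      by case: eqVneq => [->|//]; rewrite lt0n; apply/eqP.
    split; first by apply: (addIr (col h M)); rewrite -Mg gx subrK.
    by move=> j jS; rewrite mxE xS.
apply: eq_fsbigr => x _; rewrite (bigD1 h) //= [in RHS](bigD1 h) //=.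
rewrite mulrA; congr (_ * _); first by rewrite mxE eqxx addn1 exprS.
by apply: eq_bigr => j jh; rewrite mxE (negPf jh) addn0.
Qed.

(** Every nonnegative combination u of the columns of [S] has det2 (m_i, u) <= 0, so there is no
    solution at all. *)
Lemma wsum_above S b (i : 'I_n) : 0 < det2 (col i M) b ->
  (forall j, j \in S -> (j <= i)%N) -> wsum S b = 0.
Proof.
move=> ib Si; rewrite /wsum fsbig1 // => x xs.
suff : det2 (col i M) b <= 0 by lia.
rewrite (det2_sols _ xs); apply: sumr_le0 => j jS.
rewrite -minor2E; have := minor2_ge0 (Si j jS).
by rewrite minor2E det2C -minor2E => ?; rewrite mulr_ge0_le0 //; lia.
Qed.

Lemma wsum_below S b (i : 'I_n) : 0 < det2 b (col i M) ->
  (forall j, j \in S -> (i <= j)%N) -> wsum S b = 0.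
Proof.
move=> ib Si; rewrite /wsum fsbig1 // => x xs.
suff : 0 <= det2 (col i M) b by rewrite det2C; lia.
rewrite (det2_sols _ xs); apply: sumr_ge0 => j jS.
by rewrite -minor2E mulr_ge0 // minor2_ge0 // Si.
Qed.

End Solutions.

Section WeightedCount.
Variables (n : nat) (M : 'M[int]_(2, n)).
Hypothesis hn : (1 < n)%N.
Hypothesis hY : forall i j : 'I_n, (i < j)%N -> 0 < minor2 M i j.
Variables (K : fieldType) (a : 'I_n -> K).
Variable chi : 'I_n -> 'I_n -> nat -> 'cV[int]_2 -> K.
Variable k : nat.
Implicit Types (S : {set 'I_n}) (b : 'cV[int]_2).

Local Notation Y i j := `|minor2 M i j|%N.
Local Notation m_ h := (col h M).

Hypothesis a_neq0 : forall i, a i != 0.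
Hypothesis Y_neq0 : forall i j : 'I_n, (i < j)%N -> (Y i j)%:R != 0 :> K.
Hypothesis chiD : forall (i j : 'I_n) r u v, (i < j)%N ->
  chi i j r (u + v) = chi i j r u * chi i j r v.
Hypothesis chil : forall (i j : 'I_n) r, (i < j)%N -> chi i j r (m_ i) = a i.
Hypothesis chir : forall (i j : 'I_n) r, (i < j)%N -> chi i j r (m_ j) = a j.
Hypothesis chi_neq0 : forall (i j : 'I_n) r u, (i < j)%N -> chi i j r u != 0.
Hypothesis chi_neq : forall (i j h : 'I_n) r, (i < j)%N -> h != i -> h != j ->
  chi i j r (m_ h) != a h.
Hypothesis chi_sum : forall (i j : 'I_n) u, (i < j)%N ->
  ~~ ((minor2 M i j %| det2 u (m_ j))%Z && (minor2 M i j %| det2 (m_ i) u)%Z) ->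
  \sum_(r < Y i j) chi i j r u = 0.
Hypothesis a_generic : forall h i j : 'I_n, (h < i)%N -> (i < j)%N ->
  a i ^+ Y h j != a h ^+ Y i j * a j ^+ Y h i.

(** The residue of the generating function at the common simple poles of its factors i and j: with
    z^u = chi(u)^-1, the remaining factors 1 - a_h z^(m_h) take the values 1 - a_h / chi(m_h). *)
Definition pair_term S (p : 'I_n * 'I_n) b : K :=
  (Y p.1 p.2)%:R^-1 * \sum_(r < Y p.1 p.2)
    (chi p.1 p.2 r b /
     \prod_(h in S | (h != p.1) && (h != p.2)) (1 - a h / chi p.1 p.2 r (m_ h))).

Definition pair_sum S b : K :=
  \sum_(p : 'I_n * 'I_n | [&& p.1 \in S, p.2 \in S & (p.1 <= k < p.2)%N])
    pair_term S p b.

(** Described by half-planes, one for each column, so that it can only grow when [S] shrinks; this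
    is what the induction on [S] requires. *)
Definition chamber S b : bool :=
  [forall i in S, if (i <= k)%N then 0 < det2 (m_ i) b else 0 < det2 b (m_ i)].

Lemma chamberP S b : reflect (forall i, i \in S ->
  if (i <= k)%N then 0 < det2 (m_ i) b else 0 < det2 b (m_ i)) (chamber S b).
Proof. exact: 'forall_implyP. Qed.

Lemma sub_chamber S S' b : S' \subset S -> chamber S b -> chamber S' b.
Proof. by move=> /fintype.subsetP SS /chamberP H; apply/chamberP => i /SS /H. Qed.

Lemma chamber_add S b u :
  (forall i, i \in S -> if (i <= k)%N then 0 <= det2 (m_ i) u else 0 <= det2 u (m_ i)) ->
  chamber S b -> chamber S (b + u).
Proof.
move=> H /chamberP C; apply/chamberP => i iS.
have := H i iS; have := C i iS; rewrite det2Dl det2Dr.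
by case: ifP => _ A B; lia.
Qed.

Lemma chi_sub (i j : 'I_n) r u v : (i < j)%N ->
  chi i j r (u - v) = chi i j r u / chi i j r v.
Proof.
by move=> ij; apply: (mulIf (chi_neq0 r v ij)); rewrite -chiD // subrK divfK ?chi_neq0.
Qed.

(** If h is i or j then chi(b - m_h) = chi(b) / a_h and the two terms agree. Otherwise the
    difference produces the factor 1 - a_h / chi(m_h), which cancels the h-th denominator. *)
Lemma pair_term_rec S (i j : 'I_n) b h : h \in S -> (i < j)%N ->
  pair_term S (i, j) b =
    (if (i != h) && (j != h) then pair_term (S :\ h) (i, j) b else 0)
    + a h * pair_term S (i, j) (b - m_ h).
Proof.
move=> hS ij; rewrite /pair_term /=.
rewrite mulrCA (mulr_sumr _ _ _ (a h)).
have [ih|ih] := eqVneq i h.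
  rewrite /= add0r -ih; congr (_ * _); apply: eq_bigr => r _.
  by rewrite chi_sub // chil // mulrA [a i * _]mulrC divfK.
have [jh|jh] := eqVneq j h.
  rewrite /= add0r -jh; congr (_ * _); apply: eq_bigr => r _.
  by rewrite chi_sub // chir // mulrA [a j * _]mulrC divfK.
rewrite /= -mulrDr -big_split; congr (_ * _); apply: eq_bigr => r _ /=.
rewrite (bigD1 h) /=; last by rewrite hS eq_sym ih eq_sym jh.
rewrite [X in _ = _ / X + _](eq_bigl (fun l => [&& l \in S,
  l != i & l != j] && (l != h))); last first.
  by move=> l; rewrite !inE; case: (l == h); rewrite ?andbF ?andbT //= !andbA.
rewrite chi_sub //.
have D : 1 - a h / chi i j r (m_ h) != 0.
  have hi : h != i by rewrite eq_sym.
  have hj : h != j by rewrite eq_sym.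
  rewrite subr_eq0 eq_sym; apply: contra (chi_neq r ij hi hj) => /eqP E.
  by rewrite -[a h](divfK (chi_neq0 r (m_ h) ij)) E mul1r.
have := chi_neq0 r (m_ h) ij.
set P := \prod_(l | _) _ in D *.
rewrite invfM; set X := chi i j r (m_ h) => X0.
have -> : chi i j r b * ((1 - a h / X)^-1 * P^-1) = (chi i j r b / P) * (1 -
  a h / X)^-1 by ring.
have -> : a h * (chi i j r b / X * ((1 - a h / X)^-1 * P^-1)) = (chi i j r b / P) *
  (1 - a h / X)^-1 * (a h / X) by ring.
set q := chi i j r b / P; set t := a h / X in D *.
have : q * ((1 - t)^-1 * (1 - t)) = q by rewrite mulVf // mulr1.
by move=> {2}<-; ring.
Qed.

Lemma pair_sum_rec S b h : h \in S ->
  pair_sum S b = pair_sum (S :\ h) b + a h * pair_sum S (b - m_ h).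
Proof.
move=> hS; rewrite /pair_sum mulr_sumr.
rewrite [X in X + _](_ : _ = \sum_(p | [&& p.1 \in S, p.2 \in S & (p.1 <= k < p.2)%N])
   if (p.1 != h) && (p.2 != h) then pair_term (S :\ h) p b else 0).
  rewrite -big_split; apply: eq_bigr => -[i j] /= /and3P[_ _ /andP[ik kj]].
  by rewrite (pair_term_rec _ hS) // (leq_ltn_trans ik).
rewrite -big_mkcondr; apply: eq_bigl => -[i j] /=; rewrite !inE.
by case: (i != h) (j != h) (i \in S) (j \in S) => [] [] [] [] //=; rewrite ?andbF ?andbT.
Qed.

(** Orthogonality makes the average over the characters vanish unless b lies in the lattice Z m_i +
    Z m_j. If it does, Cramer's rule gives the only candidate solution, and the chamber condition
    makes its coordinates nonnegative. *)
Lemma wsum2 (i j : 'I_n) b : (i <= k < j)%N -> chamber [set i; j]%SET b ->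
  wsum M a [set i; j]%SET b = pair_sum [set i; j]%SET b.
Proof.
move=> /andP[ik kj] Cb.
have ij : (i < j)%N by exact: leq_ltn_trans kj.
have iNj : i != j by rewrite -val_eqE ltn_eqF.
rewrite /pair_sum (bigD1 (i, j)) /=; last by rewrite !inE !eqxx orbT ik kj.
rewrite big1 ?addr0; last first.
  move=> [p q] /= /andP[/and3P[]]; rewrite !inE => pS qS /andP[pk kq].
  have -> : p = i.
    by case/orP: pS => /eqP // pj; move: pk; rewrite pj leqNgt kj.
  have -> : q = j.
    by case/orP: qS => /eqP // qi; move: kq; rewrite qi ltnNge ik.
  by rewrite eqxx.
rewrite /pair_term /=.
under eq_bigr => r _.
  rewrite big_pred0; last by move=> l; rewrite !inE; case: eqP => //; case: eqP.
  rewrite divr1; over.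
have Y0 : (0 : int) < minor2 M i j by exact: hY.
have [bi bj] : 0 < det2 (m_ i) b /\ 0 < det2 b (m_ j).
  have /chamberP C := Cb; split.
    by have := C i; rewrite !inE eqxx ik => /(_ isT).
  by have := C j; rewrite !inE eqxx orbT leqNgt kj => /(_ isT).
have solE x : sols M [set i; j]%SET b x ->
    det2 b (m_ j) = (x i 0)%:Z * minor2 M i j /\ det2 (m_ i) b = (x j 0)%:Z * minor2 M i j.
  move=> xs; split.
    rewrite det2C (det2_sols _ xs) (bigD1 i) ?inE ?eqxx //= (bigD1 j) ?inE ?eqxx ?orbT
      ?(eq_sym j) //=.
    rewrite big1 => [|l]; last by rewrite !inE; case: eqP => //; case: eqP.
    by rewrite det2uu det2C -minor2E; ring.
  rewrite (det2_sols _ xs) (bigD1 i) ?inE ?eqxx //= (bigD1 j) ?inE ?eqxx ?orbT ?(eq_sym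
    j) //=.
  rewrite big1 => [|l]; last by rewrite !inE; case: eqP => //; case: eqP.
  by rewrite det2uu -minor2E; ring.
have [/andP[/dvdzP[p pE] /dvdzP[q qE]]|D] :=
  boolP ((minor2 M i j %| det2 b (m_ j))%Z && (minor2 M i j %| det2 (m_ i) b)%Z);
  last first.
  rewrite chi_sum // mulr0 /wsum fsbig1 // => x /solE[A B].
  by move: D; rewrite A B !dvdz_mull.
have p0 : 0 <= p by rewrite -(pmulr_lge0 _ Y0) -pE ltW.
have q0 : 0 <= q by rewrite -(pmulr_lge0 _ Y0) -qE ltW.
case: p p0 pE => // p _ pE; case: q q0 qE => // q _ qE.
have bE : b = p%:Z *: m_ i + q%:Z *: m_ j.
  have := det2_basis (m_ i) (m_ j) b; rewrite -minor2E pE qE.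
  rewrite ![_%:Z * _]mulrC -!scalerA -scalerDr => /matrixP E.
  by apply/matrixP => c d; have := E c d; rewrite !mxE => /mulfI; apply; rewrite gt_eqF.
have chiM r u c : chi i j r (c%:Z *: u) = chi i j r u ^+ c.
  elim: c => [|c IHc].
    rewrite scale0r; apply: (mulIf (chi_neq0 r 0 ij)).
    by rewrite -chiD // addr0 mul1r.
  by rewrite intS scalerDl scale1r chiD // IHc exprS.
rewrite (eq_bigr (fun=> a i ^+ p * a j ^+ q)); last first.
  by move=> r _; rewrite bE chiD // !chiM chil // chir.
rewrite sumr_const card_ord -[X in _ * X]mulr_natr mulrCA mulVf ?Y_neq0 // mulr1.
pose x0 : 'cV[nat]_n := \col_l (if l == i then p else if l == j then q else 0%N).
rewrite /wsum (_ : sols M _ b = [set x0]).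
  rewrite fsbig_set1 (bigD1 i) //= (bigD1 j) ?(eq_sym j) //= big1 => [|l /andP[li lj]].
    by rewrite !mxE eqxx eq_sym (negPf iNj) eqxx mulr1.
  by rewrite mxE (negPf li) (negPf lj).
apply/seteqP; split => x /=.
  move=> xs; have [xi xj] := solE x xs; case: xs => _ xS.
  apply/matrixP => l c; rewrite ord1 mxE {c}; have [->|li] := eqVneq l i.
    have : (x i 0)%:Z * minor2 M i j = p%:Z * minor2 M i j by rewrite -xi.
    by move/(mulIf (lt0r_neq0 Y0)) => [].
  have [->|lj] := eqVneq l j.
    have : (x j 0)%:Z * minor2 M i j = q%:Z * minor2 M i j by rewrite -xj.
    by move/(mulIf (lt0r_neq0 Y0)) => [].
  by rewrite xS // !inE negb_or li.
move=> ->; split.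
  rewrite mulmx_sumcol (bigD1 i) //= (bigD1 j) ?(eq_sym j) //= big1 => [|l /andP[li lj]].
    by rewrite !mxE eqxx eq_sym (negPf iNj) eqxx addr0 -bE.
  by rewrite mxE (negPf li) (negPf lj) scale0r.
by move=> l; rewrite !inE negb_or mxE => /andP[/negPf -> /negPf ->].
Qed.

(** The chamber is convex, so once both endpoints lie in it every intermediate point does, and the
    functional equation can be iterated along the segment. *)
Lemma path_eq S f b h c : 
  (forall u, chamber S u -> f u = a h * f (u - m_ h)) ->
  chamber S b -> chamber S (b + c%:Z *: m_ h) ->
  f (b + c%:Z *: m_ h) = a h ^+ c * f b.
Proof.
move=> Hf Cb Cc.
(* An affine function of s that is positive at 0 and at c is positive in between. *)
have aux (A B : int) (s : nat) : (s <= c)%N -> 0 < A -> 0 < A + c%:Z * B -> 0 < A +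
  s%:Z * B.
  move=> sc A0 AB0; have [B0|B0] := leP 0 B; first by rewrite ltr_wpDr // mulr_ge0.
  by apply: (lt_le_trans AB0); rewrite lerD2l ler_wnM2r // ltW.
have Cs s : (s <= c)%N -> chamber S (b + s%:Z *: m_ h).
  move=> sc; apply/chamberP => i iS.
  move/chamberP/(_ i iS): Cb; move/chamberP/(_ i iS): Cc.
  by rewrite !det2Dl !det2Dr !det2Zl !det2Zr; case: ifP => _ C0 C1; apply: aux C1 C0.
have : (c <= c)%N by [].
elim: {1 3 4}c => [|s IH] sc; first by rewrite scale0r addr0 mul1r.
rewrite Hf ?Cs // exprS -mulrA -IH ?(ltnW sc) //; congr (_ * f _).
by rewrite intS scalerDl scale1r [m_ h + _]addrC addrA addrK.
Qed.

Theorem wsum_pair_sum S b : S != finset.set0 -> chamber S b ->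
  wsum M a S b = pair_sum S b.
Proof.
elim: {S}#|S| {-2}S (leqnn #|S|) b => [|c IH] S.
  by rewrite leqn0 cards_eq0 => /eqP ->; rewrite eqxx.
move=> Sc b S0 Cb.
have [/existsP[i0 /andP[i0S i0k]]|/existsPn Nlow] := boolP [exists i,
  (i \in S) && (i <= k)%N]; last first.
  have {S0} /finset.set0Pn [i0 i0S] := S0.
  have hi i : i \in S -> (k < i)%N.
    by move=> iS; have := Nlow i; rewrite iS /= -ltnNge.
  pose i := [arg min_(i < i0 in S) nat_of_ord i].
  have [iS imin] : i \in S /\ forall j, j \in S -> (i <= j)%N.
    by rewrite /i; case: arg_minnP => // i1 ? ?; split.
  move/chamberP/(_ i iS): Cb; rewrite leqNgt hi //= => Cb.
  rewrite (wsum_below hn hY a Cb imin) /pair_sum big1 // => -[p q] /= /and3P[pS _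
    /andP[pk _]].
  by have := hi p pS; rewrite ltnNge pk.
have [/existsP[j0 /andP[j0S j0k]]|/existsPn Nhigh] := boolP [exists i,
  (i \in S) && (k < i)%N]; last first.
  have lo i : i \in S -> (i <= k)%N.
    by move=> iS; have := Nhigh i; rewrite iS /= -leqNgt.
  pose i := [arg max_(i > i0 in S) nat_of_ord i].
  have [iS imax] : i \in S /\ forall j, j \in S -> (j <= i)%N.
    by rewrite /i; case: arg_maxnP => // i1 ? ?; split.
  move/chamberP/(_ i iS): Cb; rewrite lo //= => Cb.
  rewrite (wsum_above hn hY a Cb imax) /pair_sum big1 // => -[p q] /= /and3P[_ qS
    /andP[_ kq]].
  by have := lo q qS; rewrite leqNgt kq.
(* From here [S] has columns on both sides; i and j are the two adjacent to the chamber, so adding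
   multiples of m_i or m_j never leaves it. *)
pose i := [arg max_(i > i0 | (i \in S) && (i <= k)%N) nat_of_ord i].
have [iS ik imax] : [/\ i \in S, (i <= k)%N & forall j, j \in S -> (j <= k)%N ->
  (j <= i)%N].
  rewrite /i; case: arg_maxnP => [|i1 /andP[? ?] H]; first by rewrite i0S.
  by split => // j jS jk; apply: H; rewrite jS.
pose j := [arg min_(i < j0 | (i \in S) && (k < i)%N) nat_of_ord i].
have [jS kj jmin] : [/\ j \in S, (k < j)%N & forall i, i \in S -> (k < i)%N -> (j <= i)%N].
  rewrite /j; case: arg_minnP => [|i1 /andP[? ?] H]; first by rewrite j0S.
  by split => // l lS kl; apply: H; rewrite lS.
clearbody i j; clear i0 i0S i0k j0 j0S j0k.
have ij : (i < j)%N by exact: leq_ltn_trans kj.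
have [Sij|] := eqVneq S [set i; j]%SET.
  by rewrite Sij wsum2 ?ik // -Sij.
move=> Sij.
have [h hS /andP[hi hj]] : exists2 h, h \in S & (h != i) && (h != j).
  apply/exists_inP; apply: contraNT Sij => /exists_inPn H.
  apply/eqP/finset.setP => h; rewrite !inE; apply/idP/idP.
    by move=> /H; rewrite negb_and !negbK.
  by case/orP => /eqP ->.
pose f u := wsum M a S u - pair_sum S u.
have fE l u : l \in S -> chamber S u -> f u = a l * f (u - m_ l).
  move=> lS Cu; rewrite /f (wsum_rec hn hY a _ lS) (pair_sum_rec _ lS).
  rewrite IH; first by ring.
  - by rewrite -ltnS (leq_trans _ Sc) // [in X in (_ < X)%N](cardsD1 l) lS.
  - apply/finset.set0Pn; have [li|li] := eqVneq l i.
      by exists j; rewrite !inE jS li -val_eqE /= gtn_eqF.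
    by exists i; rewrite !inE iS eq_sym li.
  - exact: sub_chamber (subD1set _ _) Cu.
suff : f b = 0 by move/eqP; rewrite subr_eq0 => /eqP.
have Ci u c' : chamber S u -> chamber S (u + c'%:Z *: m_ i).
  apply: chamber_add => l lS; rewrite det2Zl det2Zr -!minor2E; case: ifP => lk.
    by rewrite mulr_ge0 // minor2_ge0 // imax.
  rewrite mulr_ge0 // minor2_ge0 // ltnW // (leq_ltn_trans ik) //.
  by rewrite ltnNge lk.
have Cj u c' : chamber S u -> chamber S (u + c'%:Z *: m_ j).
  apply: chamber_add => l lS; rewrite det2Zl det2Zr -!minor2E; case: ifP => lk.
    by rewrite mulr_ge0 // minor2_ge0 // ltnW // (leq_ltn_trans lk).
  by rewrite mulr_ge0 // minor2_ge0 // jmin // ltnNge lk.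
have Yabs (p q : 'I_n) : (p < q)%N -> (Y p q)%:Z = det2 (m_ p) (m_ q).
  by move=> pq; rewrite gez0_abs -?minor2E // ltW // hY.
(* The relation Y_hj m_i = Y_hi m_j + Y_ij m_h yields two walks inside the chamber from b to the
   same point. They multiply f(b) by a_i^Y_hj and by a_h^Y_ij a_j^Y_hi, which differ by genericity,
   so f(b) = 0. The case h > k is the mirror image, starting with steps along m_j. *)
have [hk|hk] := leqP h k.
  have hi' : (h < i)%N by rewrite ltn_neqAle val_eqE hi imax.
  have E : b + (Y h j)%:Z *: m_ i = b + (Y h i)%:Z *: m_ j + (Y i j)%:Z *: m_ h.
    rewrite !Yabs ?(ltn_trans hi' ij) // -addrA; congr (b + _).
    by rewrite addrC det2_basis.
  have C1 := Ci b (Y h j) Cb; have C2 := Cj b (Y h i) Cb.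
  have := path_eq (fE i ^~ iS) Cb C1.
  rewrite E (path_eq (fE h ^~ hS) C2) -?E // (path_eq (fE j ^~ jS) Cb C2).
  move/eqP; rewrite mulrA -subr_eq0 -mulrBl mulf_eq0 subr_eq0 eq_sym.
  by rewrite (negPf (a_generic hi' ij)) => /eqP.
have hj' : (j < h)%N by rewrite ltn_neqAle eq_sym val_eqE hj jmin.
have E : b + (Y i h)%:Z *: m_ j = b + (Y j h)%:Z *: m_ i + (Y i j)%:Z *: m_ h.
  rewrite !Yabs ?(ltn_trans ij hj') // -addrA; congr (b + _).
  by rewrite det2_basis.
have C1 := Cj b (Y i h) Cb; have C2 := Ci b (Y j h) Cb.
have := path_eq (fE j ^~ jS) Cb C1.
rewrite E (path_eq (fE h ^~ hS) C2) -?E // (path_eq (fE i ^~ iS) Cb C2).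
move/eqP; rewrite mulrA -subr_eq0 -mulrBl mulf_eq0 subr_eq0 eq_sym mulrC.
by rewrite (negPf (a_generic ij hj')) => /eqP.
Qed.

End WeightedCount.

(** * The complex exponential and its divided remainders *)

Section ComplexExp.
Variable R : realType.
Local Notation K := R[i].

Lemma cexp0 : cexp (0 : K) = 1.
Proof. by rewrite /cexp /= expR0 cos0 sin0 mul1r mulr0. Qed.

Lemma cexpD (z w : K) : cexp (z + w) = cexp z * cexp w.
Proof.
case: z => a b; case: w => c d; rewrite /cexp /=; simpc.
by rewrite expRD cosD sinD; apply/eqP; rewrite eq_complex /=; apply/andP; split;
  apply/eqP; ring.
Qed.

Lemma cexp_real (r : R) : cexp (r%:C%C) = (expR r)%:C%C.
Proof. by rewrite /cexp /= cos0 sin0 mulr1 mulr0. Qed.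

Lemma cexp_neq0 (z : K) : cexp z != 0.
Proof.
apply/eqP => z0; have := cexpD z (- z).
by rewrite subrr cexp0 z0 mul0r => /eqP; rewrite oner_eq0.
Qed.

Lemma cexpN (z : K) : cexp (- z) = (cexp z)^-1.
Proof. by apply: (mulIf (cexp_neq0 z)); rewrite -cexpD addNr cexp0 mulVf ?cexp_neq0. Qed.

Definition exp_poly m : {poly K} := \poly_(k < m) (k`!)%:R^-1.

(** Real and imaginary parts of the Taylor polynomial of t |-> exp(t u) for real t, so that the
    remainder can be estimated by real calculus on [0, 1]. *)
Let repoly (u : K) m : {poly R} := \poly_(k < m) (complex.Re (u ^+ k) / (k`!)%:R).
Let impoly (u : K) m : {poly R} := \poly_(k < m) (complex.Im (u ^+ k) / (k`!)%:R).

Let ReX (a b : R) k : complex.Re ((a +i* b)%C ^+ k.+1) = a *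
  complex.Re ((a +i* b)%C ^+ k) - b * complex.Im ((a +i* b)%C ^+ k).
Proof. by rewrite exprS; case: (_ ^+ k) => c d /=. Qed.
Let ImX (a b : R) k : complex.Im ((a +i* b)%C ^+ k.+1) = a *
  complex.Im ((a +i* b)%C ^+ k) + b * complex.Re ((a +i* b)%C ^+ k).
Proof. by rewrite exprS; case: (_ ^+ k) => c d /=; ring. Qed.

Let deriv_repoly (a b : R) m :
  (repoly (a +i* b)%C m.+1)^`() = a *: repoly (a +i* b)%C m - b *: impoly (a +i* b)%C m.
Proof.
apply/polyP => k; rewrite coef_deriv !coefB !coefZ !coef_poly ltnS.
case: ltnP => km; last by rewrite mul0rn !mulr0 subrr.
rewrite ReX factS natrM -mulr_natr.
by field; rewrite nat1r !pnatr_eq0 -lt0n fact_gt0.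
Qed.

Let deriv_impoly (a b : R) m :
  (impoly (a +i* b)%C m.+1)^`() = a *: impoly (a +i* b)%C m + b *: repoly (a +i* b)%C m.
Proof.
apply/polyP => k; rewrite coef_deriv coefD !coefZ !coef_poly ltnS.
case: ltnP => km; last by rewrite mul0rn !mulr0 addr0.
rewrite ImX factS natrM -mulr_natr.
by field; rewrite nat1r !pnatr_eq0 -lt0n fact_gt0.
Qed.

Let f (a b : R) m (t : R) := expR (t * a) * cos (t * b) - (repoly (a +i* b)%C m).[t].
Let g (a b : R) m (t : R) := expR (t * a) * sin (t * b) - (impoly (a +i* b)%C m).[t].

Let derf (a b : R) m (t : R) : is_derive t 1 (f a b m.+1) (a * f a b m t - b * g a b m t).
Proof.
have D := is_derive_poly (repoly (a +i* b)%C m.+1) t.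
apply: is_derive_eq.
rewrite deriv_repoly /f /g !hornerE /GRing.scale /=; ring.
Qed.

Let derg (a b : R) m (t : R) : is_derive t 1 (g a b m.+1) (a * g a b m t + b * f a b m t).
Proof.
have D := is_derive_poly (impoly (a +i* b)%C m.+1) t.
apply: is_derive_eq.
rewrite deriv_impoly /f /g !hornerE /GRing.scale /=; ring.
Qed.

Let bound_step (h dh : R -> R) (B t : R) : h 0 = 0 ->
  (forall x : R, is_derive x 1 h (dh x)) -> (forall x, 0 <= x <= 1 -> `|dh x| <= B) ->
  0 <= t <= 1 -> `|h t| <= B.
Proof.
move=> h0 hd dhB /andP[t0 t1].
have [|c /andP[]] := @MVT_segment R h dh 0 t t0 (fun x _ => hd x).
  apply: continuous_subspaceT => x; apply/differentiable_continuous/derivable1_diffP.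
  by have [] := hd x.
rewrite !bnd_simp h0 !subr0 => c0 ct ->.
have B0 : 0 <= B by apply: le_trans (dhB 0 _); rewrite ?normr_ge0 // lexx ler01.
rewrite normrM (ger0_norm t0) -[leRHS]mulr1 ler_pM //.
by apply: dhB; rewrite c0 (le_trans ct).
Qed.

(** By induction on m: the derivative of the remainder of order m + 1 is a + i b times the remainder
    of order m, and the mean value theorem on [0, t] costs no further constant since t <= 1. *)
Let bound_fg (a b : R) m (t : R) : `|a| <= 1 -> 0 <= t <= 1 ->
  `|f a b m t| <= expR 1 * (`|a| + `|b|) ^+ m /\ `|g a b m t| <= expR 1 * (`|a| +
    `|b|) ^+ m.
Proof.
move=> a1; elim: m t => [|m IH] t t01.
  rewrite /f /g /repoly /impoly !poly_def !big_ord0 !horner0 !subr0 expr0 mulr1 !normrM.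
  have E : `|expR (t * a)| <= expR 1.
    rewrite ger0_norm ?expR_ge0 // ler_expR.
    have [t0 t1] := andP t01.
    by rewrite (le_trans (ler_norm _)) // normrM (ger0_norm t0) mulr_ile1.
  by split; rewrite -[leRHS]mulr1 ler_pM // ler_norml ?cos_geN1 ?cos_le1 ?sin_geN1 ?sin_le1.
have F0 p : f a b p.+1 0 = 0.
  rewrite /f !mul0r expR0 cos0 mulr1 horner_coef0 coef_poly /= fact0.
  by rewrite divr1 subrr.
have G0 p : g a b p.+1 0 = 0.
  by rewrite /g !mul0r expR0 sin0 mulr0 horner_coef0 coef_poly /= mul0r subrr.
split.
  apply: bound_step (F0 m) (@derf a b m) _ t01 => x /IH[F G].
  rewrite (le_trans (ler_normB _ _)) // !normrM exprS mulrCA mulrDl.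
  by rewrite lerD // ler_wpM2l.
apply: bound_step (G0 m) (@derg a b m) _ t01 => x /IH[F G].
rewrite (le_trans (ler_normD _ _)) // !normrM exprS mulrCA mulrDl.
by rewrite lerD // ler_wpM2l.
Qed.

Lemma normc_real (r : R) : `|r%:C%C : K| = `|r|%:C%C.
Proof. by rewrite normc_def /= expr0n addr0 sqrtr_sqr. Qed.

Lemma normc_i : `|'i%C : K| = 1.
Proof. by rewrite normc_def /= expr0n add0r expr1n sqrtr1. Qed.

Lemma cexp_taylor m : exists C : R, forall u : K, `|u| <= 1 ->
  `|cexp u - (exp_poly m).[u]| <= C%:C%C * `|u| ^+ m.
Proof.
(* One factor 2 for adding the real and imaginary parts, and 2^m from |a| + |b| <= 2 |u|. *)
exists (expR 1 *+ 2 * 2 ^+ m) => -[a b] u1.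
have [A B] : `|a|%:C%C <= `|(a +i* b)%C : K| /\ `|b|%:C%C <= `|(a +i* b)%C : K|.
  split; first exact: (normc_ge_Re (a +i* b)%C).
  have := normc_ge_Re ('i%C * (a +i* b)%C); rewrite normrM normc_i mul1r /=.
  by rewrite mul0r mul1r sub0r normrN.
have a1 : `|a| <= 1 by rewrite -lecR (le_trans A).
have [F G] := @bound_fg a b m 1 a1 (introT andP (conj ler01 (lexx _))).
have -> : cexp (a +i* b)%C - (exp_poly m).[(a +i* b)%C] = (f a b m 1 +i* g a b m 1)%C.
  suff -> : (exp_poly m).[(a +i* b)%C] = (repoly (a +i* b)%C m).[1]%:C%C + 'i%C *
    (impoly (a +i* b)%C m).[1]%:C%C.
    rewrite /f /g !mul1r [RHS]complexE [X in X - _]complexE /= !rmorphB /=.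
    by rewrite !rmorphM /=; ring.
  rewrite /exp_poly /repoly /impoly !horner_poly !rmorph_sum /= mulr_sumr -big_split.
  apply: eq_bigr => k _ /=; rewrite expr1n !mulr1 {1}[_ ^+ k]complexE.
  by rewrite !rmorphM /= !fmorphV !rmorph_nat; ring.
rewrite [X in `|X|]complexE /= (le_trans (ler_normD _ _)) // normrM normc_i mul1r.
rewrite !normc_real; apply: le_trans (_ : (expR 1 *+ 2 * (`|a| + `|b|) ^+ m)%:C%C <= _).
  by rewrite -rmorphD lecR mulr2n mulrDl lerD.
rewrite !rmorphM !rmorphXn /= -mulrA -exprMn ler_wpM2l //.
  by rewrite ler0c mulrn_wge0 // expR_ge0.
apply: lerXn2r; rewrite ?nnegrE ?mulr_ge0 ?normr_ge0 ?ler0c ?addr_ge0 ?ler0n //.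
by rewrite rmorphD rmorph_nat mulr2n mulrDl mul1r lerD.
Qed.

End ComplexExp.

Section Phi.
Variable R : realType.
Local Notation K := R[i].

(** The entire function sum_k u^k / (m + k)!. The whole family is kept because it is closed under
    differentiation, phi_m' = phi_m - m phi_(m+1); this gives the derivatives of (exp u - 1) / u =
    phi_1(u) through its removable singularity. *)
Definition phi m (u : K) : K :=
  if u == 0 then (m`!)%:R^-1 else (cexp u - (exp_poly R m).[u]) / u ^+ m.

Definition phi_poly m L : {poly K} := \poly_(k < L) ((m + k)`!)%:R^-1.

Lemma exp_polyD m L u : (exp_poly R (m + L)).[u] = (exp_poly R m).[u] + u ^+ m *
  (phi_poly m L).[u].
Proof.
rewrite /exp_poly /phi_poly !horner_poly big_split_ord /=; congr (_ + _).
by rewrite mulr_sumr; apply: eq_bigr => k _ /=; rewrite exprD; ring.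
Qed.

Lemma phi_poly0 m L : (phi_poly m L.+1).[0] = (m`!)%:R^-1.
Proof. by rewrite horner_coef0 coef_poly /= addn0. Qed.

Lemma phi_taylor m L : exists C : R, forall u : K, `|u| <= 1 ->
  `|phi m u - (phi_poly m L).[u]| <= C%:C%C * `|u| ^+ L.
Proof.
have [C HC] := cexp_taylor R (m + L).
(* Adding 1 covers u = 0 with L = 0, where the left side is 1 / m! and the bound is the constant
   itself. *)
exists (`|C| + 1) => u u1.
have C0 : 0 <= (`|C| + 1)%:C%C :> K by rewrite ler0c addr_ge0.
rewrite /phi; have [->|u0] := eqVneq u 0.
  rewrite normr0; case: L {HC} => [|L]; last first.
    by rewrite phi_poly0 subrr normr0 mulr_ge0 // exprn_ge0.
  rewrite expr0 mulr1 /phi_poly poly_def big_ord0 horner0 subr0 normfV.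
  rewrite (le_trans (_ : _ <= 1)) //.
    by rewrite normr_nat invf_le1 ?ltr0n ?fact_gt0 // ler1n fact_gt0.
  by rewrite rmorphD rmorph1 lerDr ler0c.
have um : u ^+ m != 0 by rewrite expf_neq0.
have -> : (cexp u - (exp_poly R m).[u]) / u ^+ m - (phi_poly m L).[u] =
   (cexp u - (exp_poly R (m + L)).[u]) / u ^+ m.
  by rewrite exp_polyD; field.
rewrite normrM normfV normrX ler_pdivrMr ?exprn_gt0 ?normr_gt0 //.
apply: (le_trans (HC u u1)).
rewrite exprD mulrA mulrAC ler_wpM2r ?exprn_ge0 // ler_wpM2r ?exprn_ge0 //.
by rewrite lecR (le_trans (ler_norm C)) // lerDl.
Qed.

Lemma is_derive_quadratic (f : K^o -> K^o) (a l : K) (C : R) :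
  (forall h : K, `|h| <= 1 -> `|f (h + a) - f a - h * l| <= C%:C%C * `|h| ^+ 2) ->
  is_derive (a : K^o) (1 : K^o) f l.
Proof.
move=> H.
suff D : (fun h : K^o => h^-1 *: (f (h *: (1 : K^o) + a) - f a)) @ 0^' --> (l : K^o).
  by apply: DeriveDef; [apply/cvg_ex; exists l|exact: cvg_lim D].
have C0 : 0 < (`|C| + 1)%:C%C :> K by rewrite ltcR ltr_wpDl.
apply/cvgrPdist_le => e e0; near=> h.
have h0 : h != 0 by near: h; exact: nbhs_dnbhs_neq.
have h1 : `|h| <= 1 by near: h; exact: dnbhs0_le.
have he : `|h| <= e / (`|C| + 1)%:C%C by near: h; apply: dnbhs0_le; rewrite divr_gt0.
rewrite /GRing.scale /= mulr1 distrC.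
have -> : h^-1 * (f (h + a) - f a) - l = h^-1 * (f (h + a) - f a - h * l) by field.
rewrite normrM normfV mulrC ler_pdivrMr ?normr_gt0 //.
apply: (le_trans (H h h1)).
rewrite expr2 mulrA ler_wpM2r //.
rewrite ler_pdivlMr // in he; apply: le_trans he; rewrite mulrC ler_wpM2l //.
by rewrite lecR (le_trans (ler_norm C)) // lerDl.
Unshelve. all: by end_near. Qed.

Lemma phi0 : phi 0 = @cexp R.
Proof.
apply/funext => u; rewrite /phi; case: eqP => [->|_].
  by rewrite fact0 invr1 cexp0.
by rewrite /exp_poly poly_def big_ord0 horner0 subr0 divr1.
Qed.

Lemma phiS m u : u != 0 -> phi m.+1 u = (phi m u - (m`!)%:R^-1) / u.
Proof.
move=> u0; rewrite /phi (negPf u0).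
rewrite -addn1 exp_polyD /phi_poly poly_def big_ord1 addn0 expr0 alg_polyC hornerC.
rewrite addn1 exprS; have um : u ^+ m != 0 by rewrite expf_neq0.
by field; rewrite u0 um pnatr_eq0 -lt0n fact_gt0.
Qed.

(** At 0 the second-order Taylor bound gives the derivative. Elsewhere the formula follows by
    induction on m, differentiating the quotient [phiS]. *)
Lemma is_derive_phi m (u : K^o) :
  is_derive u (1 : K^o) (phi m : K^o -> K^o) (phi m u - m%:R * phi m.+1 u).
Proof.
have [->|u0] := eqVneq u 0.
  have [C HC] := phi_taylor m 2.
  apply: (@is_derive_quadratic _ _ _ C) => h h1; apply: le_trans (HC h h1).
  rewrite addr0 /phi_poly !horner_poly !big_ord_recr big_ord0 /= add0r addn0 addn1.
  rewrite expr0 mulr1 expr1 [in X in _ <= X]opprD addrA.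
  suff -> : phi m 0 - m%:R * phi m.+1 0 = (m.+1)`!%:R^-1 by rewrite /phi eqxx [h * _]mulrC.
  rewrite /phi !eqxx factS natrM; field.
  by rewrite nat1r !pnatr_eq0 -lt0n fact_gt0.
elim: m => [|m IH].
  rewrite mul0r subr0 phi0.
  have [C HC] := cexp_taylor R 2.
  apply: (@is_derive_quadratic _ _ _ (complex.Re `|cexp u| * C)) => h h1.
  rewrite cexpD.
  have -> : cexp h * cexp u - cexp u - h * cexp u = cexp u * (cexp h - (exp_poly R 2).[h]).
    rewrite /exp_poly horner_poly !big_ord_recr big_ord0 /= fact0 factS fact0 expr0 invr1.
    by rewrite expr1 add0r !mul1r; ring.
  have -> : (complex.Re `|cexp u| * C)%:C%C = `|cexp u| * C%:C%C.
    by rewrite rmorphM; congr (_ * _); apply: RRe_real; exact: normr_real.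
  by rewrite normrM -mulrA ler_wpM2l //; exact: HC.
pose g : K^o -> K^o := (phi m - cst (m`!)%:R^-1) * (fun x : K^o => x^-1).
apply: (@near_eq_is_derive _ _ _ g).
  near=> x; have x0 : x != 0.
    by near: x; apply: (@cvgr_neq0 _ _ _ _ _ id u) => //; exact: cvg_id.
  by rewrite /g phiS.
have V : is_derive u (1 : K^o) (fun x : K^o => x^-1) (- u ^- 2).
  apply: DeriveDef; first exact: derivableV.
  by rewrite deriveV // derive_id /GRing.scale /= mulr1.
apply: is_derive_eq.
rewrite /GRing.scale /= !fctE !phiS // factS natrM.
by field; rewrite u0 nat1r !pnatr_eq0 -lt0n fact_gt0.
Unshelve. all: by end_near. Qed.

End Phi.

(** * Jets of the transform of the box spline at the origin *)

Section FormalPartial.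
Variable K : comNzRingType.
Implicit Types P Q : {poly {poly K}}.

(* In {poly {poly K}} the outer variable stands for the second coordinate. *)
Definition formal_partial (i : 'I_2) P : {poly {poly K}} :=
  if i == 0 then swapXY (swapXY P)^`() else P^`().

Lemma formal_partialD i P Q : formal_partial i (P + Q) = formal_partial i P +
  formal_partial i Q.
Proof. by rewrite /formal_partial; case: ifP => _; rewrite ?rmorphD ?derivD ?rmorphD. Qed.

Lemma formal_partialM i P Q : formal_partial i (P * Q) = formal_partial i P * Q + P *
  formal_partial i Q.
Proof.
rewrite /formal_partial; case: ifP => _; last exact: derivM.
by rewrite rmorphM derivM rmorphD !rmorphM /= !swapXYK.
Qed.

Lemma formal_partialC i c : formal_partial i c%:P%:P = 0.
Proof.
by rewrite /formal_partial; case: ifP => _; rewrite ?swapXY_polyC ?map_polyC /= ?derivC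
  ?raddf0.
Qed.

Lemma coef_formal_partial0 P a b : (formal_partial 0 P)`_b`_a = P`_b`_a.+1 *+ a.+1.
Proof. by rewrite /formal_partial eqxx coef_swapXY coef_deriv coefMn coef_swapXY. Qed.

Lemma coef_formal_partial1 P a b : (formal_partial 1 P)`_b`_a = P`_b.+1`_a *+ b.+1.
Proof. by rewrite /formal_partial /= coef_deriv coefMn. Qed.

Lemma coef_iter_formal_partial0 P a b n :
  (iter n (formal_partial 0) P)`_b`_a = P`_b`_(a + n) *+ (a + n) ^_ n.
Proof.
elim: n a => [|n IH] a; first by rewrite addn0 ffactn0.
rewrite iterS coef_formal_partial0 IH addSnnS -mulrnA; congr (_ *+ _).
by rewrite addnS ffactnSr; congr (_ * _)%N; lia.
Qed.

Lemma coef_iter_formal_partial1 P a b n :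
  (iter n (formal_partial 1) P)`_b`_a = P`_(b + n)`_a *+ (b + n) ^_ n.
Proof.
elim: n b => [|n IH] b; first by rewrite addn0 ffactn0.
rewrite iterS coef_formal_partial1 IH addSnnS -mulrnA; congr (_ *+ _).
by rewrite addnS ffactnSr; congr (_ * _)%N; lia.
Qed.

Definition linpoly (c0 c1 : K) : {poly {poly K}} := (c0 *: 'X)%:P + c1%:P *: 'X.

Lemma formal_partial_linpoly i c0 c1 : formal_partial i (linpoly c0 c1) =
  (if i == 0 then c0 else c1)%:P%:P.
Proof.
rewrite /formal_partial /linpoly; case: ifP => _; last first.
  by rewrite derivD derivC add0r derivZ derivX alg_polyC.
rewrite rmorphD /= swapXY_polyC map_polyZ map_polyX /= derivD derivZ derivX alg_polyC.
rewrite -mul_polyC rmorphM /= swapXY_polyC map_polyC swapXY_X -polyCM derivC addr0.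
by rewrite swapXY_polyC map_polyC.
Qed.

Definition comp_lin (p : {poly K}) (l : {poly {poly K}}) : {poly {poly K}} :=
  (map_poly (polyC \o polyC) p).[l].

Lemma formal_partial_comp_lin i p l : formal_partial i (comp_lin p l) =
  comp_lin p^`() l * formal_partial i l.
Proof.
rewrite /comp_lin; elim/poly_ind: p => [|p c IH].
  by rewrite !rmorph0 deriv0 !rmorph0 !horner0 mul0r -[0]/(0%:P) -[0]/((0:K)%:P)
    formal_partialC.
have -> : (p * 'X + c%:P)^`() = p^`() * 'X + p.
  by rewrite derivD derivC addr0 derivM derivX mulr1.
rewrite !rmorphD !rmorphM /= !map_polyX map_polyC /= !hornerE formal_partialD
  formal_partialM formal_partialC IH.
by ring.
Qed.

Lemma coef_comp_scale (u : K) (q : {poly K}) a : (q \Po (u *: 'X))`_a = q`_a * u ^+ a.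
Proof.
rewrite coef_comp_poly.
have E (i : 'I_(size q)) : q`_i * ((u *: 'X) ^+ i)`_a = if (i == a :> nat) then q`_a *
  u ^+ a else 0.
  by rewrite exprZn coefZ coefXn eq_sym; case: eqP => [->|_]; rewrite ?mulr1 ?mulr0.
rewrite (eq_bigr _ (fun i _ => E i)) -big_mkcond.
have [aq|aq] := ltnP a (size q).
  by rewrite (big_pred1 (Ordinal aq)).
rewrite big_pred0 => [|i]; last by apply/negbTE; rewrite neq_ltn (leq_trans _ aq).
by rewrite nth_default ?mul0r.
Qed.

(** The restriction P(u X, v X) to a line through the origin. Applying D^v to a power of a linear
    form produces monomials in its two coefficients, so the recursion sees the jet of [Bhat] only
    through such restrictions. *)
Definition line_eval (u v : K) (P : {poly {poly K}}) : {poly K} :=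
  (map_poly (comp_poly (u *: 'X)) P).[v *: 'X].

Lemma line_evalM u v P Q : line_eval u v (P * Q) = line_eval u v P * line_eval u v Q.
Proof. by rewrite /line_eval rmorphM hornerM. Qed.

Lemma line_eval1 u v : line_eval u v 1 = 1.
Proof. by rewrite /line_eval rmorph1 hornerC. Qed.

Lemma line_eval_prod u v I (r : seq I) (F : I -> {poly {poly K}}) :
  line_eval u v (\prod_(i <- r) F i) = \prod_(i <- r) line_eval u v (F i).
Proof. by apply: (big_morph _ (line_evalM u v) (line_eval1 u v)). Qed.

Lemma coef_line_eval u v P r :
  (line_eval u v P)`_r = \sum_(b < r.+1) P`_b`_(r - b) * u ^+ (r - b) * v ^+ b.
Proof.
pose F b := if (b <= r)%N then P`_b`_(r - b) * u ^+ (r - b) * v ^+ b else 0.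
have -> : (line_eval u v P)`_r = \sum_(b < size P) F b.
  rewrite /line_eval /map_poly horner_poly coef_sum; apply: eq_bigr => b _.
  rewrite exprZn -scalerAr coefZ coefMXn /F ltnNge; case: leqP => br /=;
    last by rewrite mulr0.
  by rewrite coef_comp_scale mulrC.
have -> : \sum_(b < size P) F b = \sum_(b < size P + r.+1) F b.
  rewrite big_split_ord /= [X in _ + X]big1 ?addr0 // => b _.
  by rewrite /F [P`_ _]nth_default ?leq_addr // coef0 !mul0r if_same.
rewrite addnC big_split_ord /= [X in _ + X]big1 ?addr0 => [|b _].
  by apply: eq_bigr => b _; rewrite /F -ltnS ltn_ord.
by rewrite /F leqNgt ltnS leq_addr.
Qed.

Lemma line_eval_comp_lin u v p c0 c1 :
  line_eval u v (comp_lin p (linpoly c0 c1)) = p \Po ((c0 * u + c1 * v) *: 'X).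
Proof.
rewrite /comp_lin; elim/poly_ind: p => [|p c IH].
  by rewrite !rmorph0 horner0 /line_eval rmorph0 horner0.
have -> : (map_poly (polyC \o polyC) (p * 'X + c%:P)).[linpoly c0 c1] =
    (map_poly (polyC \o polyC) p).[linpoly c0 c1] * linpoly c0 c1 + c%:P%:P.
  by rewrite rmorphD rmorphM /= map_polyX map_polyC /= !hornerE.
have -> : line_eval u v ((map_poly (polyC \o polyC) p).[linpoly c0 c1] *
  linpoly c0 c1 + c%:P%:P)
  = line_eval u v (map_poly (polyC \o polyC) p).[linpoly c0 c1] *
    line_eval u v (linpoly c0 c1) + c%:P.
  rewrite -line_evalM /line_eval rmorphD hornerD; congr (_ + _).
  by rewrite /= map_polyC hornerC /= comp_polyC.
rewrite IH comp_polyD comp_polyM comp_polyX comp_polyC; congr (_ * _ + _).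
rewrite /line_eval /linpoly rmorphD -[c1%:P *: _]mul_polyC rmorphM /= !map_polyC
  map_polyX /=.
by rewrite !hornerE /= comp_polyZ comp_polyX comp_polyC scalerA mul_polyC scalerA -scalerDl.
Qed.

End FormalPartial.

(** * Jets at the origin, compared with formal polynomials *)

Section Jets.
Variable R : realType.
Local Notation K := R[i].
Local Notation V := 'cV[K]_2.

(** The derivative G is required on the whole domain although only values at 0 are recorded: the
    iterated [partialD] differentiates functions, so a derivative at the single point 0 would not be
    enough. *)
Fixpoint jet1 N (F : K^o -> K^o) (p : {poly K}) : Prop :=
  F 0 = p.[0] /\
  if N is N'.+1 then
    exists G : K^o -> K^o,
      (forall x : K^o, is_derive x (1 : K^o) F (G x)) /\ jet1 N' G p^`()
  else True.

Fixpoint jet2 N (F : V -> K^o) (P : {poly {poly K}}) : Prop :=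
  F 0 = P`_0`_0 /\
  if N is N'.+1 then
    exists G : 'I_2 -> V -> K^o,
      forall i, (forall z : V, is_derive z (delta_mx i 0 : V) F (G i z)) /\
                jet2 N' (G i) (formal_partial i P)
  else True.

Lemma jet1_lin N (F G : K^o -> K^o) p q (c : K) : jet1 N F p -> jet1 N G q ->
  jet1 N (fun x => F x - c * G x) (p - c *: q).
Proof.
elim: N F G p q => [|N IH] F G p q; first by move=> [F0 _] [G0 _]; split=> //;
  rewrite F0 G0 !hornerE.
move=> [F0 [F' [dF jF]]] [G0 [G' [dG jG]]]; split; first by rewrite F0 G0 !hornerE.
exists (fun x => F' x - c * G' x); split; last by rewrite derivB derivZ; exact: IH.
move=> x; have dFx := dF x; have dGx := dG x.
exact: (@is_deriveB _ _ _ F (c \*: G)).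
Qed.

(** The truncations obey the same law as the functions, ([phi_poly] m (L+1))' = [phi_poly] m L - m
    [phi_poly] (m+1) L. Each derivative costs one coefficient, whence N < L. *)
Lemma jet1_phi N m L : (N < L)%N -> jet1 N (phi m : K^o -> K^o) (phi_poly R m L).
Proof.
elim: N m L => [|N IH] m [|L] // NL.
  by split=> //; rewrite phi_poly0 /phi eqxx.
split; first by rewrite phi_poly0 /phi eqxx.
exists (fun u => phi m u - m%:R * phi m.+1 u); split=> [x|].
  exact: is_derive_phi.
have -> : (phi_poly R m L.+1)^`() = phi_poly R m L - m%:R *: phi_poly R m.+1 L.
  apply/polyP => k; rewrite coef_deriv coefB coefZ !coef_poly ltnS.
  case: ltnP => _; last by rewrite mul0rn mulr0 subrr.
  rewrite addnS addSn factS natrM -[_^-1 *+ _]mulr_natr.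
  have f0 : ((m + k)`!)%:R != 0 :> K by rewrite pnatr_eq0 -lt0n fact_gt0.
  have s0 : ((m + k).+1)%:R != 0 :> K by rewrite pnatr_eq0.
  move: s0 f0; rewrite -addnS natrD; move: (k.+1%:R) (_`!%:R) => t f s0 f0.
  by field; rewrite f0 s0.
by apply: jet1_lin; apply: IH.
Qed.

Lemma jet2_weaken N F P : jet2 N.+1 F P -> jet2 N F P.
Proof.
elim: N F P => [|N IH] F P [F0 [G jG]]; first by split.
by split=> //; exists G => i; have [dG jGi] := jG i; split=> //; exact: IH.
Qed.

Lemma jet2_const N (c : K) : jet2 N (fun=> c) c%:P%:P.
Proof.
elim: N c => [|N IH] c; split; rewrite ?coefC //.
exists (fun _ _ => 0) => i; split=> [z|]; first exact: is_derive_cst.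
by rewrite formal_partialC -!polyC0; exact: IH.
Qed.

Lemma jet2_add N F G P Q : jet2 N F P -> jet2 N G Q ->
  jet2 N (fun z => F z + G z) (P + Q).
Proof.
elim: N F G P Q => [|N IH] F G P Q; first by move=> [F0 _] [G0 _]; split=> //;
  rewrite F0 G0 !coefD.
move=> [F0 [F' jF]] [G0 [G' jG]]; split; first by rewrite F0 G0 !coefD.
exists (fun i z => F' i z + G' i z) => i; have [dF jF'] := jF i; have [dG jG'] := jG i.
split=> [z|]; last by rewrite formal_partialD; exact: IH.
have dFz := dF z; have dGz := dG z; exact: (@is_deriveD _ _ _ F G).
Qed.

Lemma jet2_mul N F G P Q : jet2 N F P -> jet2 N G Q ->
  jet2 N (fun z => F z * G z) (P * Q).
Proof.
have C00 (A B : {poly {poly K}}) : (A * B)`_0`_0 = A`_0`_0 * B`_0`_0.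
  by rewrite -!horner_coef0 !hornerM.
elim: N F G P Q => [|N IH] F G P Q.
  by move=> [F0 _] [G0 _]; split=> //; rewrite F0 G0 C00.
(* The product rule pairs a derivative, of jet order N, with an undifferentiated factor, of order N
   + 1, so the latter is weakened first. *)
move=> jF jG; have wF := jet2_weaken jF; have wG := jet2_weaken jG.
case: jF => F0 [F' jF]; case: jG => G0 [G' jG].
split; first by rewrite F0 G0 C00.
exists (fun i z => F' i z * G z + F z * G' i z) => i.
have [dF jF'] := jF i; have [dG jG'] := jG i.
split=> [z|]; last by rewrite formal_partialM; apply: jet2_add; apply: IH.
have dFz := dF z; have dGz := dG z.
have := (@is_deriveM _ _ F G z _ _ _ dFz dGz).
by move/is_derive_eq; apply; rewrite /GRing.scale /= addrC mulrC.
Qed.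

Lemma jet2_prod N I (r : seq I) (F : I -> V -> K^o) (P : I -> {poly {poly K}}) :
  (forall i, jet2 N (F i) (P i)) ->
  jet2 N (fun z => \prod_(i <- r) F i z) (\prod_(i <- r) P i).
Proof.
move=> H; elim: r => [|i r IH].
  rewrite big_nil (_ : (fun _ => _) = (fun=> 1)); first by apply: (jet2_const N 1).
  by apply/funext => z; rewrite big_nil.
rewrite big_cons (_ : (fun _ => _) = (fun z => F i z * \prod_(i <- r) F i z)).
  exact: jet2_mul.
by apply/funext => z; rewrite big_cons.
Qed.

Lemma is_derive_dir (F : K^o -> K^o) (x d c : K^o) :
  is_derive x (1 : K^o) F d -> is_derive x c F (c * d).
Proof.
move=> [dF <-].
have dif : differentiable F x by apply/derivable1_diffP.
apply: DeriveDef; first exact: diff_derivable.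
by rewrite !deriveE // -[c in LHS]mulr1 -[c * 1]/(c *: (1 : K^o)) linearZ.
Qed.

Lemma is_derive_comp_lin (F : K^o -> K^o) (d c0 c1 : K) (z : V) (i : 'I_2) :
  is_derive (c0 * z 0 0 + c1 * z 1 0 : K^o) (1 : K^o) F d ->
  is_derive z (delta_mx i 0 : V) (fun z : V => F (c0 * z 0 0 + c1 * z 1 0) : K^o)
    ((if i == 0 then c0 else c1) * d).
Proof.
move=> dF.
(* Along a basis vector the difference quotient of the composite is literally that of F in the
   direction c0 or c1, so no chain rule is needed. *)
have E : (fun h : K^o => h^-1 *: (((fun z : V => F (c0 * z 0 0 + c1 *
  z 1 0)) \o shift z) (h *: (delta_mx i 0 : V))
    - F (c0 * z 0 0 + c1 * z 1 0))) =
  (fun h : K^o => h^-1 *: ((F \o shift (c0 * z 0 0 + c1 *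
    z 1 0 : K^o)) (h *: ((if i == 0 then c0 else c1) : K^o)) - F (c0 * z 0 0 + c1 *
    z 1 0))).
  apply/funext => h /=; congr (_ *: (F _ - _)); rewrite !mxE /GRing.scale /=.
  have [->|->] : i = 0 \/ i = 1.
  - by case: i => [[|[|//]] ?]; [left|right]; exact: val_inj.
  - by rewrite /=; ring.
  - by rewrite /=; ring.
have [D1 D2] := is_derive_dir ((if i == 0 then c0 else c1)) dF; apply: DeriveDef;
  rewrite /derivable /derive E; [exact: D1|exact: D2].
Qed.

Lemma jet2_comp N F p (c0 c1 : K) : jet1 N F p ->
  jet2 N (fun z : V => F (c0 * z 0 0 + c1 * z 1 0)) (comp_lin p (linpoly c0 c1)).
Proof.
have C0 q : (comp_lin q (linpoly c0 c1))`_0`_0 = q.[0].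
  rewrite /comp_lin -!horner_coef0 /linpoly.
  elim/poly_ind: q => [|q c IH]; first by rewrite rmorph0 !horner0.
  by rewrite rmorphD rmorphM /= map_polyX map_polyC /= !hornerE /= !hornerE.
elim: N F p => [|N IH] F p.
  by move=> [F0 _]; split=> //; rewrite !mxE !mulr0 addr0 F0 C0.
move=> [F0 [G [dG jG]]]; split; first by rewrite !mxE !mulr0 addr0 F0 C0.
pose cc (i : 'I_2) := if i == 0 then c0 else c1.
exists (fun i z => cc i * G (c0 * z 0 0 + c1 * z 1 0)) => i; split=> [z|]; last first.
  rewrite formal_partial_comp_lin formal_partial_linpoly mulrC; apply: jet2_mul;
    first exact: jet2_const.
  exact: IH.
exact: is_derive_comp_lin.
Qed.

Lemma jet2_partialD N F P i : jet2 N.+1 F P -> jet2 N (partialD i F) (formal_partial i P).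
Proof.
move=> [_ [G /(_ i)[dG jG]]]; rewrite (_ : partialD i F = G i) //.
by apply/funext => z; have [] := dG z.
Qed.

Lemma jet2_iter_partialD N n F P i : jet2 (N + n) F P ->
  jet2 N (iter n (partialD i) F) (iter n (formal_partial i) P).
Proof.
elim: n N => [|n IH] N; first by rewrite addn0; exact.
by rewrite addnS -addSn => jF; apply: jet2_partialD; apply: IH.
Qed.

Lemma multiD_jet2 N F P (v : nat * nat) : jet2 N F P -> (v.1 + v.2 <= N)%N ->
  multiD v F 0 = P`_v.2`_v.1 * (v.1`! * v.2`!)%N%:R.
Proof.
move=> jF vN; have := jF; rewrite -(subnK vN) addnA.
move/(@jet2_iter_partialD _ _ _ _ 1)/(@jet2_iter_partialD _ _ _ _ 0).
rewrite /multiD; case: (N - _)%N => [|?] [-> _];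
by rewrite coef_iter_formal_partial0 coef_iter_formal_partial1 !add0n !ffactnn -mulrnA
  mulnC mulr_natr.
Qed.

Lemma BfactorE (s : K) : Bfactor s = phi 1 (- 'i%C * s).
Proof.
have i0 : 'i%C != 0 :> K by rewrite -normr_eq0 normc_i oner_eq0.
rewrite /Bfactor /phi mulf_eq0 oppr_eq0 (negPf i0) /=; case: eqP => [_|/eqP s0].
  by rewrite factS fact0 invr1.
rewrite /exp_poly horner_poly big_ord1 fact0 invr1 expr0 mulr1 expr1 mulNr.
by field; rewrite ?i0 ?s0.
Qed.

Definition Bjet n (M : 'M[int]_(2, n)) d : {poly {poly K}} :=
  \prod_(j < n) comp_lin (phi_poly R 1 d.+1)
    (linpoly (- 'i%C * (M 0 j)%:~R) (- 'i%C * (M 1 j)%:~R)).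

Lemma jet2_Bhat n (M : 'M[int]_(2, n)) d : jet2 d (@Bhat R n M) (Bjet M d).
Proof.
rewrite (_ : Bhat M = fun z => \prod_(j < n)
   phi 1 (- 'i%C * (M 0 j)%:~R * z 0 0 + - 'i%C * (M 1 j)%:~R * z 1 0)); last first.
  apply/funext => z; apply: eq_bigr => j _; rewrite BfactorE; congr (phi 1 _).
  rewrite mxE !big_ord_recl big_ord0 !mxE (_ : lift ord0 ord0 = 1); last exact: val_inj.
  by ring.
by apply: jet2_prod => j; apply: jet2_comp; exact: jet1_phi.
Qed.

End Jets.

(** * The polynomial part *)

Section Truncation.
Variable K : comNzRingType.
Implicit Types p q : {poly K}.

Definition eq_trunc d p q := forall r, (r <= d)%N -> p`_r = q`_r.

Lemma eq_trunc_mul d p p' q q' : eq_trunc d p p' -> eq_trunc d q q' -> eq_trunc d (p *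
  q) (p' * q').
Proof.
move=> E F r rd; rewrite !coefM; apply: eq_bigr => i _.
have ir : (i <= r)%N by rewrite -ltnS.
by rewrite E ?F // (leq_trans _ rd) // leq_subr.
Qed.

Lemma eq_trunc_prod d I (s : seq I) (p q : I -> {poly K}) :
  (forall i, eq_trunc d (p i) (q i)) -> eq_trunc d (\prod_(i <- s) p i) (\prod_(i <- s)
    q i).
Proof.
move=> E; elim: s => [|i s IH]; first by rewrite !big_nil.
by rewrite !big_cons; exact: eq_trunc_mul.
Qed.

Lemma eq_trunc_comp_scale d p q u : eq_trunc d p q ->
  eq_trunc d (p \Po (u *: 'X)) (q \Po (u *: 'X)).
Proof. by move=> E r rd; rewrite !coef_comp_scale E. Qed.

Lemma trunc_inv d p : p`_0 = 1 -> exists q, eq_trunc d (p * q) 1.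
Proof.
(* The truncated geometric series in 1 - p: the error (1 - p)^(d+1) is divisible by X^(d+1) because
   p has constant term 1. *)
move=> p0; exists (\sum_(k < d.+1) (1 - p) ^+ k).
have E : p * (\sum_(k < d.+1) (1 - p) ^+ k) = 1 - (1 - p) ^+ d.+1.
  by rewrite -[1 - _ ^+ _]opprB subrX1 -mulNr opprB subKr.
have [s sE] : exists s, 1 - p = s * 'X.
  exists (\poly_(i < size p) (1 - p)`_i.+1); apply/polyP => i; rewrite coefMX.
  case: i => [|i]; first by rewrite coefB coef1 p0 subrr.
  rewrite coef_poly; case: ltnP => //= ip.
  by rewrite coefB coef1 nth_default ?subr0 // ltnW.
by move=> r rd; rewrite E sE exprMn coefB coefMXn ltnS rd subr0.
Qed.

End Truncation.

Lemma sum_antidiag (V : nmodType) (F : nat -> nat -> V) J r : (r <= J)%N ->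
  \sum_(v : 'I_J.+1 * 'I_J.+1 | (v.1 + v.2 == r)%N) F v.1 v.2 =
  \sum_(b < r.+1) F (r - b)%N b.
Proof.
move=> rJ.
rewrite (reindex_onto (fun b : 'I_r.+1 => (inord (r - b), inord b) : 'I_J.+1 * 'I_J.+1)
   (fun v => inord v.2)) /=; last first.
  move=> [a b] /= /eqP ab; have br : (b < r.+1)%N by rewrite ltnS -ab leq_addl.
  by congr (_, _); apply: val_inj; rewrite /= !inordK //= -?ab ?addnK //; lia.
have E1 (b : 'I_r.+1) : nat_of_ord (inord (r - b) : 'I_J.+1) = (r - b)%N.
  by rewrite inordK // ltnS (leq_trans (leq_subr _ _)).
have E2 (b : 'I_r.+1) : nat_of_ord (inord b : 'I_J.+1) = b.
  by rewrite inordK // (leq_trans (ltn_ord b)).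
apply: eq_big => b; last by rewrite E1 E2.
by rewrite E1 E2 subnK -1?ltnS // eqxx inord_val eqxx.
Qed.

Section PolynomialPart.
Variables (R : realType) (n : nat) (M : 'M[int]_(2, n)) (k : 'I_n).
Local Notation K := R[i].
Local Notation V := 'cV[K]_2.
Local Notation d := (n - 2)%N.

Let e0 (l : 'I_n) : K := (M 1 l)%:~R.
Let e1 (l : 'I_n) : K := - (M 0 l)%:~R.

(** Divided powers of the forms y_l x - x_l y. The operators D^v only lower the exponent and
    multiply the coefficients, so this family contains all the p_j. *)
Definition power_sum (c : 'I_n -> K) r (z : V) : K^o :=
  \sum_(l < n) c l * ((e0 l * z 0 0 + e1 l * z 1 0) ^+ r / (r`!)%:R).

Lemma partialD_power_sum c r i :
  partialD i (power_sum c r.+1) =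
  power_sum (fun l => c l * (if i == 0 then e0 l else e1 l)) r.
Proof.
apply/funext => z; rewrite /partialD.
have D (l : 'I_n) : is_derive z (delta_mx i 0 : V)
    (fun z : V => (c l * ((e0 l * z 0 0 + e1 l * z 1 0) ^+ r.+1 / (r.+1`!)%:R)) : K^o)
    (c l * (if i == 0 then e0 l else e1 l) * ((e0 l * z 0 0 + e1 l *
      z 1 0) ^+ r / (r`!)%:R)).
  pose x : K^o := e0 l * z 0 0 + e1 l * z 1 0.
  have Dx : is_derive x (1 : K^o) (fun x : K^o => c l * (x ^+ r.+1 / (r.+1`!)%:R) : K^o)
     (c l * (x ^+ r / (r`!)%:R)).
    have E := @is_deriveX _ _ (id : K^o -> K^o) r.+1 x 1 1 (is_derive_id _ _).
    have {}E := @is_deriveZ _ _ _ _ (c l / (r.+1`!)%:R) _ _ _ E.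
    rewrite (_ : (fun _ => _) = (c l / (r.+1`!)%:R) \*: (id : K^o -> K^o) ^+ r.+1);
      last first.
      by apply/funext => y; rewrite /= /GRing.scale /= fctE; ring.
    apply: is_derive_eq; rewrite /GRing.scale /= mulr1 factS natrM.
    by field; rewrite nat1r !pnatr_eq0 -lt0n fact_gt0.
  have := is_derive_comp_lin i Dx; move/is_derive_eq; apply.
  by rewrite mulrCA mulrA.
have := @is_derive_sum _ _ _ n _ z _ _ D.
rewrite (_ : \sum_(_ < n) _ = power_sum c r.+1).
  by case=> _ ->.
by apply/funext => y; rewrite fct_sumE.
Qed.

Lemma multiD_power_sum c r (v : nat * nat) :
  multiD v (power_sum c (r + (v.1 + v.2))) =
  power_sum (fun l => c l * e0 l ^+ v.1 * e1 l ^+ v.2) r.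
Proof.
case: v => v0 v1; rewrite /multiD /=.
have -> : iter v1 (partialD 1) (power_sum c (r + (v0 + v1))) =
    power_sum (fun l => c l * e1 l ^+ v1) (r + v0).
  rewrite addnA; elim: v1 (r + v0)%N => [|m IH] s.
    by rewrite addn0 /=; congr power_sum; apply/funext => l; rewrite mulr1.
  rewrite addnS -addSn /= IH partialD_power_sum; congr power_sum.
  by apply/funext => l /=; rewrite exprSr mulrA.
elim: v0 r => [|m IH] s.
  by rewrite addn0 /=; congr power_sum; apply/funext => l; rewrite mulr1.
rewrite addnS -addSn /= IH partialD_power_sum; congr power_sum.
by apply/funext => l /=; rewrite exprSr; ring.
Qed.

(** This is Y_hl, the value at m_h of the form y_l x - x_l y; it vanishes for h = l, which makes
    that factor of the products below a constant polynomial. *)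
Let t l h : K := (M 1 l * M 0 h - M 1 h * M 0 l)%:~R.

(* A truncation of (1 - exp (- u)) / u; its truncated inverse td below is the Todd
   series u / (1 - exp (- u)). *)
Definition phi_neg : {poly K} := phi_poly R 1 d.+1 \Po ((-1) *: 'X).

Lemma phi_neg0 : phi_neg`_0 = 1.
Proof. by rewrite /phi_neg coef_comp_scale coef_poly /= addn0 factS fact0 invr1 mulr1. Qed.

Variable td : {poly K}.
Hypothesis tdP : eq_trunc d (phi_neg * td) 1.

Definition todd l : {poly K} := \prod_(h < n) (td \Po (t l h *: 'X)).

Let Phi l : {poly K} := \prod_(h < n) (phi_neg \Po (t l h *: 'X)).

Lemma todd_inv l : eq_trunc d (Phi l * todd l) 1.
Proof.
have E1 : 1 = \prod_(h < n) (1 : {poly K}) by rewrite big1.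
rewrite /Phi /todd -big_split /= [X in eq_trunc _ _ X]E1.
apply: eq_trunc_prod => h; rewrite -comp_polyM.
rewrite (_ : 1 = 1 \Po (t l h *: 'X)); last by rewrite rmorph1.
exact: eq_trunc_comp_scale.
Qed.

(** The left side is the degree-r coefficient of the jet along the line of direction -i (y_l, -x_l).
    Each column enters the jet with another factor -i, and (-i)(-i) = -1 turns phi_1 into
    [phi_neg]. *)
Lemma Bjet_coef l r :
  \sum_(b < r.+1) (- 'i%C) ^+ r * e0 l ^+ (r - b) * e1 l ^+ b * (Bjet R M d)`_b`_(r - b)
  = (Phi l)`_r.
Proof.
have -> : Phi l = line_eval (- 'i%C * e0 l) (- 'i%C * e1 l) (Bjet R M d).
  rewrite /Bjet line_eval_prod; apply: eq_bigr => h _.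
  rewrite line_eval_comp_lin /phi_neg -comp_polyA comp_polyZ comp_polyX scalerA.
  congr (_ \Po (_ *: _)); rewrite /t /e0 /e1 rmorphB !rmorphM /=.
  have i2 : 'i%C * 'i%C = -1 :> K by rewrite -expr2 sqr_i.
  transitivity ('i%C * 'i%C * (((M 1 l)%:~R * (M 0 h)%:~R - (M 1 h)%:~R *
    (M 0 l)%:~R)) : K).
    by rewrite i2.
  by ring.
rewrite coef_line_eval; apply: eq_bigr => b _.
have br : (b <= r)%N by rewrite -ltnS.
rewrite -{1}(subnK br) exprD !exprMn; ring.
Qed.

Definition kap l : K := (\prod_(j < n | j != l) t l j)^-1.

(** For fixed column L the recursion reads sum_(l <= j) Phi_(j-l) p_l = 0 for j > 0, up to the power
    of the linear form. These are the equations that determine the coefficients of the inverse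
    series of Phi, that is, of [todd]. *)
Lemma p_power_sum j : (j <= d)%N -> @p_ R n M k j =
  power_sum (fun l => if (k < l)%N then kap l * (todd l)`_j else 0) (d - j).
Proof.
elim/ltn_ind: j => j IH jd.
have [j0|j0] := posnP j.
  rewrite j0 p_0E subn0; apply/funext => z; rewrite /p_zero /power_sum mulr_sumr.
  rewrite big_mkcond; apply: eq_bigr => l _; case: ifP => _; last by rewrite mul0r.
  have -> : (todd l)`_0 = 1.
    have := todd_inv l (leq0n _); rewrite coefM big_ord1 subnn coef1 /=.
    suff -> : (Phi l)`_0 = 1 by rewrite mul1r.
    rewrite /Phi -horner_coef0 horner_prod big1 // => h _.
    by rewrite horner_coef0 coef_comp_scale phi_neg0 mulr1.
  by rewrite mulr1 /kap /e0 /e1 mulNr [LHS]mulrA [LHS]mulrC; congr (_ * _); exact: mulrC.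
rewrite p_recE //; apply/funext => z; rewrite /p_step.
have E (l : 'I_j) (v : 'I_j.+1 * 'I_j.+1) : (v.1 + v.2 == j - l)%N ->
    multiD (v.1 : nat, v.2 : nat) (@p_ R n M k l) z * (- 'i%C) ^+ (v.1 + v.2)%N *
      (multiD (v.1 : nat, v.2 : nat) (@Bhat R n M) 0 / (v.1`! * v.2`!)%N%:R) =
    \sum_(L < n | (k < L)%N) kap L * ((e0 L * z 0 0 + e1 L * z 1 0) ^+ (d - j) / ((d -
      j)`!)%:R) *
       ((todd L)`_l * ((- 'i%C) ^+ (j - l) * e0 L ^+ v.1 * e1 L ^+ v.2 *
         (Bjet R M d)`_v.2`_v.1)).
  move=> /eqP vE.
  have lj : (l < j)%N by [].
  rewrite IH ?(leq_trans (ltnW lj)) //.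
  have -> : (d - l = (d - j) + (v.1 + v.2))%N by rewrite vE; lia.
  rewrite (@multiD_power_sum _ (d - j) (v.1 : nat, v.2 : nat)).
  rewrite (multiD_jet2 (jet2_Bhat R M d)) /=; last by rewrite vE; lia.
  rewrite mulfK ?pnatr_eq0 -?lt0n ?muln_gt0 ?fact_gt0 // vE.
  rewrite /power_sum !mulr_suml [RHS]big_mkcond; apply: eq_bigr => L _.
  by case: ifP => _; [ring|rewrite !mul0r].
under eq_bigr => l _ do rewrite (eq_bigr _ (E l)) exchange_big /=.
rewrite exchange_big /= /power_sum -sumrN [in LHS]big_mkcond.
apply: eq_bigr => L _; case: ifP => kL; last by rewrite mul0r.
under eq_bigr => l _ do rewrite -mulr_sumr -mulr_sumr.
rewrite -mulr_sumr -mulrN [RHS]mulrAC; congr (_ * _).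
have V (l : 'I_j) : \sum_(v : 'I_j.+1 * 'I_j.+1 | (v.1 + v.2 == j - l)%N)
   ((- 'i%C) ^+ (j - l) * e0 L ^+ v.1 * e1 L ^+ v.2 * (Bjet R M d)`_v.2`_v.1) =
     (Phi L)`_(j - l).
  rewrite -Bjet_coef.
  rewrite (@sum_antidiag _ (fun a b => (- 'i%C) ^+ (j - l) * e0 L ^+ a * e1 L ^+ b *
    (Bjet R M d)`_b`_a)) //.
  exact: leq_subr.
under eq_bigr => l _ do rewrite V.
have := todd_inv L jd; rewrite mulrC coefM big_ord_recr /= subnn coef1 gtn_eqF //.
suff -> : (Phi L)`_0 = 1 by rewrite mulr1 addrC => /eqP; rewrite addr_eq0 => /eqP ->.
rewrite /Phi -horner_coef0 horner_prod big1 // => h _.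
by rewrite horner_coef0 coef_comp_scale phi_neg0 mulr1.
Qed.

(** p_j pairs the degree j part of the Todd series with the degree n - 2 - j part of the
    exponential, so the sum over j is a single coefficient of a product. *)
Lemma p_eE z : p_e M k z = \sum_(l < n | (k < l)%N)
  kap l * ((exp_poly R d.+1 \Po ((e0 l * z 0 0 + e1 l * z 1 0) *: 'X)) * todd l)`_d.
Proof.
rewrite /p_e (eq_bigr (fun j : 'I_d.+1 => power_sum
  (fun l => if (k < l)%N then kap l * (todd l)`_j else 0) (d - j) z)); last first.
  by move=> j _; rewrite p_power_sum // -ltnS.
rewrite exchange_big /= [RHS]big_mkcond; apply: eq_bigr => l _.
case: ifP => kl; last by rewrite big1 // => j _; rewrite mul0r.
rewrite [_ * todd l]mulrC coefM mulr_sumr; apply: eq_bigr => j _.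
rewrite coef_comp_scale coef_poly ltnS leq_subr /= -mulrA; congr (_ * (_ * _)).
exact: mulrC.
Qed.

End PolynomialPart.

(** * Lagrange interpolation along the lines dual to the columns *)

(** q is its own interpolation polynomial at the nodes u_i; compare the coefficients of degree #|P|
    - 1. In particular the sum vanishes when q has smaller degree. *)
Lemma lagrange_lead (F : fieldType) (I : finType) (P : pred I) (u : I -> F) (q : {poly F}) :
  {in P &, injective u} -> (size q <= #|P|)%N ->
  \sum_(i | P i) q.[u i] / \prod_(h | P h && (h != i)) (u i - u h) = q`_(#|P|.-1).
Proof.
move=> uinj qP.
pose D i := \prod_(h | P h && (h != i)) (u i - u h).
pose L i : {poly F} := \prod_(h | P h && (h != i)) ('X - (u h)%:P).
have card i : P i -> #|[pred h | P h && (h != i)]| = #|P|.-1.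
  move=> Pi; have := cardD1 i P; rewrite -[i \in P]/(P i) Pi => ->.
  by rewrite add1n /=; apply: eq_card => h; rewrite !inE andbC.
have Lmonic i : L i \is monic by apply: monic_prod => h _; exact: monicXsubC.
have sL i : P i -> size (L i) = #|P|.
  move=> Pi; rewrite /L -(@big_enum _ _ _ _ [pred h | P h && (h != i)]) size_prod_XsubC.
  rewrite -cardE card // prednK //.
  by apply/card_gt0P; exists i.
(* The difference has size at most #|P| and vanishes at #|P| distinct nodes. *)
have E : q = \sum_(i | P i) (q.[u i] / D i) *: L i.
  apply/eqP; rewrite -subr_eq0; apply/negP => /negP N0.
  have := @max_poly_roots _ _ [seq u i | i <- enum P] N0.
  rewrite size_map -cardE => H.
  have : (#|P| < size (q - \sum_(i | P i) (q.[u i] / D i) *: L i)%R)%N.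
    apply: H; last by rewrite map_inj_in_uniq ?enum_uniq // => x y; rewrite !mem_enum;
      exact: uinj.
    apply/allP => x /mapP[a]; rewrite mem_enum => Pa ->; move: a Pa => i Pi.
    rewrite /root hornerD hornerN horner_sum (bigD1 i) //= hornerZ.
    rewrite [X in _ - (_ + X)]big1 => [|j /andP[Pj ji]]; last first.
      rewrite hornerZ /L (bigD1 i) /=; last by rewrite eq_sym ji andbT.
      by rewrite hornerM hornerXsubC subrr mul0r mulr0.
    have -> : (L i).[u i] = D i.
      by rewrite /L horner_prod; apply: eq_bigr => h _; rewrite hornerXsubC.
    rewrite addr0 divfK ?subrr // /D; apply/prodf_neq0 => h /andP[Ph hi].
    by rewrite subr_eq0; apply: contra hi => /eqP /uinj -> //.
  rewrite ltnNge (leq_trans (size_polyD _ _)) // geq_max qP size_polyN.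
  apply: (leq_trans (size_sum _ _ _)); apply/bigmax_leqP => i Pi.
  by rewrite (leq_trans (size_scale_leq _ _)) // sL.
rewrite [in RHS]E coef_sum; apply: eq_bigr => i Pi; rewrite coefZ.
by rewrite -(sL i Pi) -lead_coefE (monicP (Lmonic i)) mulr1.
Qed.

Section Symbol.
Variable K : fieldType.
Implicit Types (P Q : {poly {poly K}}) (p q : {poly K}).

(* The bivariate polynomial has degree at most r in the inner variable at the
   r-th power of the outer one, and p collects the extremal coefficients. *)
Definition symbol P p := forall r, (size (P`_r)%R <= r.+1)%N /\ P`_r`_r = p`_r.

Lemma symbol_mul P Q p q : symbol P p -> symbol Q q -> symbol (P * Q) (p * q).
Proof.
move=> sP sQ r; split.
  rewrite coefM (leq_trans (size_sum _ _ _)) //; apply/bigmax_leqP => i _.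
  have [Pi _] := sP i; have [Qi _] := sQ (r - i)%N.
  rewrite (leq_trans (size_polyMleq _ _)) //.
  have ir : (i <= r)%N by rewrite -ltnS.
  lia.
rewrite !coefM coef_sum; apply: eq_bigr => i _.
have ir : (i <= r)%N by rewrite -ltnS.
have [Pi <-] := sP i; have [Qi <-] := sQ (r - i)%N.
rewrite coefM (bigD1 (inord i)) //= inordK // big1 ?addr0 // => a.
rewrite -val_eqE /= inordK // => ai.
have [ia|ia] := ltnP i a; first by rewrite nth_default ?mul0r // (leq_trans Pi).
rewrite [X in _ * X]nth_default ?mulr0 // (leq_trans Qi) //.
by have : (a < i)%N; [rewrite ltn_neqAle ai|lia].
Qed.

Lemma symbol1 : symbol 1 1.
Proof.
move=> r; rewrite !coef1; case: r => [|r]; last by rewrite size_poly0 coef0.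
by rewrite size_poly1 coef1.
Qed.

Lemma symbol_prod I (s : seq I) (P : I -> {poly {poly K}}) (p : I -> {poly K}) :
  (forall i, symbol (P i) (p i)) -> symbol (\prod_(i <- s) P i) (\prod_(i <- s) p i).
Proof.
move=> H; elim: s => [|i s IH]; first by rewrite !big_nil; exact: symbol1.
by rewrite !big_cons; exact: symbol_mul.
Qed.

(** The polynomial p((a + c u) X), written in the outer variable X with coefficients polynomial in
    u; here u will be the position on a line of linear forms. *)
Definition affine_scale p (a c : K) : {poly {poly K}} :=
  \poly_(j < size p) (p`_j *: (a%:P + c *: 'X) ^+ j).

Lemma symbol_affine_scale p a c : symbol (affine_scale p a c) (p \Po (c *: 'X)).
Proof.
move=> r; rewrite coef_comp_scale coef_poly; case: ltnP => rp; last first.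
  by rewrite size_poly0 coef0 nth_default // mul0r.
have s2 : (size (a%:P + c *: 'X)%R <= 2)%N.
  rewrite (leq_trans (size_polyD _ _)) // geq_max (leq_trans (size_polyC_leq1 _)) //.
  by rewrite (leq_trans (size_scale_leq _ _)) // size_polyX.
have sX j : (size ((a%:P + c *: 'X) ^+ j)%R <= j.+1)%N.
  by rewrite (leq_trans (size_poly_exp_leq _ _)) // ltnS; nia.
split; first by rewrite (leq_trans (size_scale_leq _ _)).
rewrite coefZ; congr (_ * _); elim: r {rp} => [|r IH]; first by rewrite !expr0 coef1.
rewrite exprS mulrDl mul_polyC -scalerAl coefD !coefZ coefXM /= IH exprS.
by rewrite nth_default ?mulr0 ?add0r // sX.
Qed.

Lemma eval_affine_scale p a c u :
  map_poly (horner_eval u) (affine_scale p a c) = p \Po ((a + c * u) *: 'X).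
Proof.
apply/polyP => r; rewrite coef_map coef_comp_scale coef_poly.
case: ltnP => rp; last by rewrite raddf0 nth_default // mul0r.
rewrite /= /horner_eval.
by rewrite hornerZ horner_exp !hornerE.
Qed.

End Symbol.

(** * Cancellation of the singular parts of the pair terms *)

Section PairSums.
Variables (K : numFieldType) (n : nat) (M : 'M[int]_(2, n)) (s : 'I_n -> K).
Hypothesis hn : (3 <= n)%N.
Hypothesis Y0 : forall i j : 'I_n, i != j -> minor2 M i j != 0.

Local Notation Y i j := ((minor2 M i j)%:~R : K).

(* The linear form w with w m_i = s_i and w m_j = s_j. *)
Definition wform (i j : 'I_n) (u : 'cV[int]_2) : K :=
  (s i * (det2 u (col j M))%:~R + s j * (det2 (col i M) u)%:~R) / Y i j.

Definition wgap i j h : K := wform i j (col h M) - s h.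

Hypothesis gen : forall i j h : 'I_n, i != j -> h != i -> h != j -> wgap i j h != 0.

Lemma wform_sym i j u : wform j i u = wform i j u.
Proof.
rewrite /wform !minor2E (det2C (col i M) u) (det2C u (col j M)) (det2C (col i M) (col j M)).
by rewrite !rmorphN /= invrN; ring.
Qed.

(** The coefficient of t^-(n-2) in the singular term of (i, j): each of the n - 2 factors 1 - exp(-t
    wgap) is t wgap to first order. *)
Definition kappa i j : K :=
  (Y i j * \prod_(h < n | (h != i) && (h != j)) wgap i j h)^-1.

Lemma kappa_anti i j : kappa j i = - kappa i j.
Proof.
rewrite /kappa -invrN -mulNr -rmorphN /=; congr (_ * _)^-1.
  by rewrite !minor2E det2C.
by apply: eq_big => [h|h _]; rewrite ?[_ && (h != i)]andbC // /wgap wform_sym.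
Qed.

Let Y0K i j : i != j -> Y i j != 0.
Proof. by move=> ij; rewrite intr_eq0 Y0. Qed.

Lemma wformr (i j : 'I_n) : i != j -> wform i j (col j M) = s j.
Proof. by move=> ij; rewrite /wform det2uu mulr0 add0r -minor2E mulfK ?Y0K. Qed.

Lemma wforml (i j : 'I_n) : i != j -> wform i j (col i M) = s i.
Proof. by move=> ij; rewrite /wform det2uu mulr0 addr0 -minor2E mulfK ?Y0K. Qed.

Variables (E td : {poly K}) (b : 'cV[int]_2).

Definition gpoly i j : {poly K} :=
  (E \Po (wform i j b *: 'X)) * \prod_(h < n) (td \Po (wgap i j h *: 'X)).

Lemma gpoly_sym i j : gpoly j i = gpoly i j.
Proof.
rewrite /gpoly wform_sym; congr (_ * _).
by apply: eq_bigr => h _; rewrite /wgap wform_sym.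
Qed.

Definition lpoly l : {poly K} :=
  (E \Po ((det2 b (col l M))%:~R *: 'X)) * \prod_(h < n) (td \Po (Y h l *: 'X)).

(** The forms w_il, for i different from l, are n - 1 points of the line {w : w m_l = s_l}. There
    kappa_il is a constant over the Lagrange denominator of node i, and the r-th coefficient of
    [gpoly] is a polynomial of degree at most r in the position, so only r = n - 2 survives, through
    its leading coefficient. *)
Lemma sum_line l r : (r <= n - 2)%N ->
  \sum_(i < n | i != l) kappa i l * (gpoly i l)`_r =
  (r == n - 2)%N%:R * (\prod_(h < n | h != l) Y h l)^-1 * (lpoly l)`_(n - 2).
Proof.
move=> rd.
have [i0 i0l] : exists i0 : 'I_n, i0 != l.
  have [->|l0] := eqVneq l (Ordinal (leq_trans (isT : (0 < 3)%N) hn)).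
    by exists (Ordinal (leq_trans (isT : (1 < 3)%N) hn)).
  by exists (Ordinal (leq_trans (isT : (0 < 3)%N) hn)); rewrite eq_sym.
(* The coordinate of w_il on the line based at w_(i0)l, obtained by solving w_(i0)l(m_i) + u_i Y_il
   = s_i. *)
pose u i : K := - wgap i0 l i / Y i l.
have wE i x : i != l -> wform i l x = wform i0 l x + (det2 x (col l M))%:~R * u i.
  move=> il; have A := Y0K il; have B := Y0K i0l.
  rewrite /u /wgap /wform; move: A B; rewrite !minor2E /det2 !(rmorphB, rmorphM) /=.
  by move=> A B; field; rewrite A B.
have gapE i h : i != l -> h != l -> wgap i l h = Y h l * (u i - u h).
  move=> il hl; have := wE h (col h M) hl; rewrite wforml // => sh.
  by rewrite /wgap wE // sh -minor2E; ring.
have uinj : {in [pred i | i != l] &, injective u}.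
  move=> i h; rewrite !inE => il hl uih; apply/eqP; apply: contraTT isT => ih.
  have := gen il (_ : h != i) hl; rewrite gapE // uih subrr mulr0 eqxx; apply.
  by rewrite eq_sym.
have cardl : #|[pred i : 'I_n | i != l]| = n.-1.
  by have := cardC1 l; rewrite card_ord => <-; apply: eq_card => i; rewrite !inE.
pose P := affine_scale E (wform i0 l b) (det2 b (col l M))%:~R *
  \prod_(h < n) affine_scale td (wgap i0 l h) (Y h l).
have sP : symbol P (lpoly l).
  apply: symbol_mul; first exact: symbol_affine_scale.
  by apply: symbol_prod => h; exact: symbol_affine_scale.
have PE i : i != l -> (gpoly i l)`_r = (P`_r).[u i].
  move=> il.
  have -> : gpoly i l = map_poly (horner_eval (u i)) P.
    rewrite /P rmorphM rmorph_prod /= eval_affine_scale /gpoly wE //; congr (_ * _).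
    apply: eq_bigr => h _; rewrite eval_affine_scale /wgap wE // minor2E.
    by congr (_ \Po (_ *: _)); ring.
  by rewrite coef_map.
have [sr tr] := sP r.
have kE i : i != l -> kappa i l = (\prod_(h < n | h != l) Y h l)^-1 *
    (\prod_(h < n | (h != l) && (h != i)) (u i - u h))^-1.
  move=> il; rewrite /kappa -invfM; congr (_^-1).
  rewrite [X in _ = X * _](bigD1 i) //= -mulrA -big_split /=; congr (_ * _).
  apply: eq_big => [h|h /andP[hi hl]]; first by rewrite andbC.
  exact: gapE.
rewrite (eq_bigr (fun i => (\prod_(h < n | h != l) Y h l)^-1 *
   ((P`_r).[u i] / \prod_(h < n | (h != l) && (h != i)) (u i - u h)))); last first.
  by move=> i il; rewrite kE // PE // -mulrA; congr (_ * _); exact: mulrC.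
rewrite -mulr_sumr (@lagrange_lead _ _ [pred i | i != l] u P`_r) //; last first.
  by rewrite cardl (leq_trans sr) //; lia.
rewrite cardl -mulrA mulrCA; congr (_ * _).
have -> : n.-1.-1 = (n - 2)%N by lia.
case: eqP => [rE|rn]; first by rewrite mul1r -rE tr.
by rewrite mul0r nth_default // (leq_trans sr) //; lia.
Qed.

Lemma sum_pairs (k r : nat) : (r <= n - 2)%N ->
  \sum_(i < n) \sum_(j < n | (i <= k < j)%N) kappa i j * (gpoly i j)`_r =
  (r == n - 2)%N%:R *
    \sum_(l < n | (k < l)%N) (\prod_(h < n | h != l) Y h l)^-1 * (lpoly l)`_(n - 2).
Proof.
move=> rd; rewrite mulr_sumr.
(* As kappa is antisymmetric, the pairs with both indices above k cancel. *)
rewrite [RHS](eq_bigr (fun l => \sum_(i < n | i != l) kappa i l * (gpoly i l)`_r));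
  last first.
  by move=> l _; rewrite sum_line // mulrA.
rewrite [LHS](exchange_big_dep (fun j : 'I_n => (k < j)%N)) /=;
  last by move=> i j _ /andP[].
apply/eqP; rewrite eq_sym -subr_eq0 -sumrB.
rewrite (eq_bigr (fun l : 'I_n => \sum_(i < n | (k < i)%N) if i != l then kappa i l *
  (gpoly i l)`_r else 0)); last first.
  move=> l kl; rewrite (bigID (fun i : 'I_n => (k < i)%N)) /=.
  rewrite [X in _ + X - _](eq_bigl (fun i : 'I_n => (i <= k < l)%N)); last first.
    move=> i; rewrite kl andbT -leqNgt; case: (leqP i k) => ik; rewrite ?andbF ?andbT //.
    by rewrite -val_eqE /= ltn_eqF // (leq_ltn_trans ik).
  by rewrite addrK -big_mkcondr; apply: eq_bigl => i; rewrite andbC.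
set T := \sum_(l | _) _.
have TN : T = - T.
  rewrite {2}/T exchange_big /= -sumrN; apply: eq_bigr => l _.
  rewrite -sumrN; apply: eq_bigr => i _.
  rewrite eq_sym; case: ifP => _; last by rewrite oppr0.
  by rewrite kappa_anti gpoly_sym mulNr.
by have /eqP := TN; rewrite -addr_eq0 -mulr2n mulrn_eq0.
Qed.

End PairSums.

(** * Expansions as the deformation parameter tends to 0 *)

Section Expansion.
Variable R : realType.
Local Notation K := R[i].
Implicit Types (F G : R -> K^o) (p q : {poly K}).

Lemma cvg_eq_near F G (l : K^o) : (\forall t \near (0 : R)^'+, F t = G t) ->
  F t @[t --> 0^'+] --> l -> G t @[t --> 0^'+] --> l.
Proof. by move=> FG Fl; apply: (cvg_trans _ Fl); exact: near_eq_cvg. Qed.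

Lemma limM F G (a b : K) : F t @[t --> 0^'+] --> (a : K^o) ->
  G t @[t --> 0^'+] --> (b : K^o) -> (F t * G t : K^o) @[t --> 0^'+] --> (a * b : K^o).
Proof. exact: cvgM. Qed.

Lemma limD F G (a b : K) : F t @[t --> 0^'+] --> (a : K^o) ->
  G t @[t --> 0^'+] --> (b : K^o) -> (F t + G t : K^o) @[t --> 0^'+] --> (a + b : K^o).
Proof. exact: cvgD. Qed.

Lemma limB F G (a b : K) : F t @[t --> 0^'+] --> (a : K^o) ->
  G t @[t --> 0^'+] --> (b : K^o) -> (F t - G t : K^o) @[t --> 0^'+] --> (a - b : K^o).
Proof. exact: cvgB. Qed.

Lemma limV F (a : K) : a != 0 -> F t @[t --> 0^'+] --> (a : K^o) ->
  ((F t)^-1 : K^o) @[t --> 0^'+] --> (a^-1 : K^o).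
Proof. exact: cvgV. Qed.

Lemma lim_cst (a : K) : (a : K^o) @[t --> (0 : R)^'+] --> (a : K^o).
Proof. exact: cvg_cst. Qed.

Lemma lim_sum I (r : seq I) (P : pred I) (Fs : I -> R -> K^o) (l : I -> K) :
  (forall i, P i -> Fs i t @[t --> 0^'+] --> (l i : K^o)) ->
  (\sum_(i <- r | P i) Fs i t : K^o) @[t --> 0^'+] --> (\sum_(i <- r | P i) l i : K^o).
Proof.
move=> H; elim: r => [|i r IH].
  by rewrite big_nil; under eq_fun do rewrite big_nil; exact: lim_cst.
rewrite big_cons; under eq_fun do rewrite big_cons.
by case: ifPn => [Pi|_]; [apply: limD; [exact: H|exact: IH]|exact: IH].
Qed.

Lemma lim_prod I (r : seq I) (P : pred I) (Fs : I -> R -> K^o) (l : I -> K) :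
  (forall i, P i -> Fs i t @[t --> 0^'+] --> (l i : K^o)) ->
  (\prod_(i <- r | P i) Fs i t : K^o) @[t --> 0^'+] --> (\prod_(i <- r | P i) l i : K^o).
Proof.
move=> H; elim: r => [|i r IH].
  by rewrite big_nil; under eq_fun do rewrite big_nil; exact: lim_cst.
rewrite big_cons; under eq_fun do rewrite big_cons.
by case: ifPn => [Pi|_]; [apply: limM; [exact: H|exact: IH]|exact: IH].
Qed.

Lemma cvg0_linear F (C e : R) : 0 < e ->
  (forall t : R, 0 < t -> t <= e -> `|F t| <= (C * t)%:C%C) ->
  F t @[t --> 0^'+] --> (0 : K^o).
Proof.
move=> e0 H; apply/cvgr0Pnorm_le => eps eps0.
have [r rE] : exists r, eps = r%:C%C.
  by exists (complex.Re eps); rewrite [LHS]complexE (ger0_Im (ltW eps0)) mulr0 addr0.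
have r0 : 0 < r by move: eps0; rewrite rE ltcR.
near=> t.
have t0 : 0 < t by near: t; exact: nbhs_right_gt.
have te : t <= e by near: t; exact: nbhs_right_le.
have tr : t <= r / (`|C| + 1) by near: t; apply: nbhs_right_le;
  rewrite divr_gt0 // ltr_wpDl.
apply: (le_trans (H t t0 te)); rewrite rE lecR.
rewrite ler_pdivlMr ?ltr_wpDl // in tr.
apply: le_trans tr; rewrite mulrC ler_pM2l //.
by rewrite (le_trans (ler_norm C)) // lerDl.
Unshelve. all: by end_near. Qed.

Lemma cvg_real_complex0 : (t%:C%C : K^o) @[t --> 0^'+] --> (0 : K^o).
Proof.
apply: (@cvg0_linear _ 1 1) => // t t0 _.
by rewrite normc_real (ger0_norm (ltW t0)) mul1r.
Qed.

Lemma cvg_horner0 p : (p.[t%:C%C] : K^o) @[t --> 0^'+] --> (p.[0] : K^o).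
Proof.
elim/poly_ind: p => [|p c IH].
  by rewrite horner0; under eq_fun do rewrite horner0; exact: lim_cst.
have -> : (p * 'X + c%:P).[0] = p.[0] * 0 + c by rewrite hornerMXaddC.
have := limD (limM IH cvg_real_complex0) (@lim_cst c).
by move=> H; apply: (cvg_eq_near _ H); apply: nearW => t; rewrite hornerMXaddC.
Qed.

(** F(t) = p(t) + o(t^d). The degree of p is left free so that products need no truncation; only its
    coefficients up to d matter, by [expands_eq_trunc]. *)
Definition expands d F p :=
  ((F t - p.[t%:C%C]) / t%:C%C ^+ d : K^o) @[t --> 0^'+] --> (0 : K^o).

Lemma near_neq0 : \forall t \near (0 : R)^'+, (t%:C%C : K) != 0.
Proof.
near=> t; have t0 : 0 < t by near: t; exact: nbhs_right_gt.
by rewrite (inj_eq (@complexI R)) gt_eqF.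
Unshelve. all: by end_near. Qed.

Lemma expands_cvg d F p : expands d F p -> F t @[t --> 0^'+] --> (p.[0] : K^o).
Proof.
move=> E; have X := @cvg_horner0 ('X^d).
have := limD (limM E X) (@cvg_horner0 p); rewrite mul0r add0r.
move=> H'; apply: (cvg_eq_near _ H'); near=> t; have t0 : t%:C%C != 0 :> K by near: t;
  exact: near_neq0.
by rewrite hornerXn /= divfK ?expf_neq0 // subrK.
Unshelve. all: by end_near. Qed.

Lemma expands_mul d F G p q : expands d F p -> expands d G q ->
  expands d (fun t => F t * G t) (p * q).
Proof.
move=> EF EG; have := limD (limM EF (expands_cvg EG)) (limM (@cvg_horner0 p) EG).
rewrite mul0r mulr0 addr0; move=> H'; apply: (cvg_eq_near _ H'); near=> t.
by rewrite hornerM /=; ring.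
Unshelve. all: by end_near. Qed.

Lemma expands_add d F G p q : expands d F p -> expands d G q ->
  expands d (fun t => F t + G t) (p + q).
Proof.
move=> EF EG; have := limD EF EG.
rewrite addr0; move=> H'; apply: (cvg_eq_near _ H'); near=> t.
by rewrite hornerD /=; ring.
Unshelve. all: by end_near. Qed.

Lemma expands_cst d (c : K) : expands d (fun=> c) c%:P.
Proof. by rewrite /expands; under eq_fun do rewrite hornerC subrr mul0r;
  exact: lim_cst. Qed.

Lemma expands_prod d I (r : seq I) (F : I -> R -> K^o) (p : I -> {poly K}) :
  (forall i, expands d (F i) (p i)) ->
  expands d (fun t => \prod_(i <- r) F i t) (\prod_(i <- r) p i).
Proof.
move=> H; elim: r => [|i r IH].
  by rewrite big_nil; under eq_fun do rewrite big_nil; exact: (expands_cst d 1).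
rewrite big_cons; under eq_fun do rewrite big_cons; exact: expands_mul.
Qed.

Lemma expands_sum d I (r : seq I) (P : pred I) (F : I -> R -> K^o) (p : I -> {poly K}) :
  (forall i, P i -> expands d (F i) (p i)) ->
  expands d (fun t => \sum_(i <- r | P i) F i t) (\sum_(i <- r | P i) p i).
Proof.
move=> H; elim: r => [|i r IH].
  rewrite big_nil; under eq_fun do rewrite big_nil.
  by rewrite -[0 : {poly K}]polyC0; exact: (expands_cst d 0).
rewrite big_cons; under eq_fun do rewrite big_cons.
by case: ifP => // Pi; apply: expands_add => //; exact: H.
Qed.

Lemma coef_shift d p : (forall r, (r < d)%N -> p`_r = 0) ->
  exists q, p = q * 'X^d /\ q.[0] = p`_d.
Proof.
move=> p0; exists (\poly_(i < size p) p`_(d + i)).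
have E : p = \poly_(i < size p) p`_(d + i) * 'X^d.
  apply/polyP => r; rewrite coefMXn; case: ltnP => rd; first exact: p0.
  rewrite coef_poly subnKC //; case: ltnP => // pr.
  by rewrite nth_default // (leq_trans pr) // leq_subr.
by split=> //; rewrite horner_coef0 [in RHS]E coefMXn ltnn subnn.
Qed.

Lemma expands_eq_trunc d F p q : eq_trunc d p q -> expands d F p -> expands d F q.
Proof.
move=> pq EF.
have [s [sE _]] : exists s : {poly K}, p - q = s * 'X^(d.+1) /\ s.[0] = (p - q)`_d.+1.
  by apply: coef_shift => r rd; rewrite coefB pq ?subrr.
have := limD EF (@cvg_horner0 (s * 'X)); rewrite hornerMX mulr0 addr0.
move=> H'; apply: (cvg_eq_near _ H'); near=> t; have t0 : t%:C%C != 0 :> K by near: t;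
  exact: near_neq0.
have -> : q.[t%:C%C] = p.[t%:C%C] - s.[t%:C%C] * t%:C%C ^+ d.+1.
  have -> : q = p - s * 'X^(d.+1) by rewrite -sE subKr.
  by rewrite hornerD hornerN hornerM hornerXn.
rewrite /= hornerMX exprS; field.
by rewrite expf_neq0.
Unshelve. all: by end_near. Qed.

Lemma expands_inv d F p q : expands d F p -> p.[0] = 1 -> eq_trunc d (p * q) 1 ->
  expands d (fun t => (F t)^-1) q.
Proof.
move=> EF p0 pq; have Fl := expands_cvg EF; rewrite p0 in Fl.
have F0 : \forall t \near (0 : R)^'+, F t != 0 by apply: (cvgr_neq0 _ Fl); rewrite oner_eq0.
have E1 : expands d (fun=> 1) (p * q).
  by apply: (expands_eq_trunc (p := 1)); [move=> r rd; rewrite pq|exact: expands_cst].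
have Finv : (F t)^-1 @[t --> 0^'+] --> (1 : K^o).
  by have := limV (oner_neq0 _) Fl; rewrite invr1.
(* 1/F - q = (1/F) ((1 - p q) - (F - p) q), and both terms in the bracket are o(t^d). *)
have := limM Finv (limB E1 (limM EF (@cvg_horner0 q))); rewrite mul0r subr0 mulr0.
move=> H'; apply: (cvg_eq_near _ H'); near=> t; have t0 : t%:C%C != 0 :> K by near: t;
  exact: near_neq0.
have Ft : F t != 0 by near: t.
rewrite /= hornerM; field.
by rewrite Ft expf_neq0.
Unshelve. all: by end_near. Qed.

Lemma expands_lead d F p : (forall r, (r < d)%N -> p`_r = 0) -> expands d F p ->
  (F t / t%:C%C ^+ d : K^o) @[t --> 0^'+] --> (p`_d : K^o).
Proof.
move=> p0 EF; have [q [pE q0]] := coef_shift p0.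
have := limD EF (@cvg_horner0 q); rewrite add0r q0.
move=> H'; apply: (cvg_eq_near _ H'); near=> t; have t0 : t%:C%C != 0 :> K by near: t;
  exact: near_neq0.
rewrite [in LHS]pE hornerM hornerXn /=; field.
by rewrite expf_neq0.
Unshelve. all: by end_near. Qed.

Lemma expands_phi d m (c : R) :
  expands d (fun t => phi m (t * c)%:C%C : K^o) (phi_poly R m d.+1 \Po (c%:C%C *: 'X)).
Proof.
have [C HC] := phi_taylor R m d.+1.
have c1 : 0 < `|c| + 1 by rewrite ltr_wpDl.
apply: (@cvg0_linear _ (C * `|c| ^+ d.+1) (`|c| + 1)^-1); first by rewrite invr_gt0.
move=> t t0 tc.
have tc1 : `|(t * c)%:C%C : K| <= 1.
  rewrite normc_real -(rmorph1 (real_complex R)) lecR normrM (gtr0_norm t0).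
  rewrite -[X in _ <= X](mulVf (lt0r_neq0 c1)).
  by rewrite ler_pM // ?lerDl // ltW.
have tt : 0 < `|t%:C%C ^+ d : K| by rewrite normr_gt0 expf_neq0 // (inj_eq (@complexI
  R)) gt_eqF.
rewrite horner_comp hornerZ hornerX -rmorphM [c * t]mulrC normrM normfV ler_pdivrMr //.
apply: le_trans (HC _ tc1) _; rewrite normrX !normc_real -!rmorphXn -!rmorphM lecR /=.
by rewrite normrM (gtr0_norm t0) exprMn [t ^+ d.+1]exprS le_eqVlt; apply/orP; left;
  apply/eqP; ring.
Qed.

Lemma cvg_cexp (c : R) : (cexp (t * c)%:C%C : K^o) @[t --> 0^'+] --> (1 : K^o).
Proof.
have := expands_cvg (expands_phi 0 0 c); rewrite phi0.
by rewrite horner_coef0 coef_comp_scale coef_poly /= addn0 fact0 invr1 mul1r.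
Qed.

End Expansion.

(** * Roots of unity and the deformed formula *)

Section RootsOfUnity.
Variable F : numClosedFieldType.

Lemma prim_root_exists N : (0 < N)%N -> exists z : F, N.-primitive_root z.
Proof.
move=> N0; pose p : {poly F} := 'X^N - 1.
have [r Dp] := closed_field_poly_normal p; move: Dp.
rewrite (monicP _) ?monicXnsubC // scale1r => Dp.
have rn1 : all N.-unity_root r by apply/allP => z; rewrite -root_prod_XsubC -Dp.
have sz_r : (N < (size r).+1)%N by rewrite -(size_prod_XsubC r id) -Dp size_XnsubC.
have [|z] := hasP (cyclic.has_prim_root N0 rn1 _ sz_r); last by exists z.
by rewrite -separable.separable_prod_XsubC -Dp cyclotomic.separable_Xn_sub_1 //
  pnatr_eq0 -lt0n.
Qed.

Lemma sum_prim_root N (z : F) (c : int) : N.-primitive_root z -> ~~ (N%:Z %| c)%Z ->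
  \sum_(r < N) (z ^+ r) ^ c = 0.
Proof.
move=> zP Nc; have N0 := prim_order_gt0 zP.
have zc1 : z ^ c != 1.
  apply: contra Nc => /eqP zc.
  rewrite dvdzE /= (prim_order_dvd zP).
  by case: c zc => c; rewrite /= ?NegzE -?exprnP -?exprnN /= => E;
     rewrite ?E // -[X in _ == X](invr1) -E invrK.
have E (r : 'I_N) : (z ^+ r) ^ c = (z ^ c) ^+ r.
  by rewrite !exprnP !exprz_exp mulrC.
rewrite (eq_bigr _ (fun r _ => E r)).
apply: (mulfI (_ : z ^ c - 1 != 0)); first by rewrite subr_eq0.
by rewrite mulr0 -subrX1 exprnP exprz_exp mulrC -exprz_exp -exprnP (prim_expr_order zP)
  exp1rz subrr.
Qed.

End RootsOfUnity.

Lemma fourier_dedekindE (R : realType) (t : int) (C : seq int) N (z : R[i]) :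
  N.-primitive_root z ->
  fourier_dedekind R t C N =
  N%:R^-1 * \sum_(r < N.-1) ((z ^+ r.+1) ^ t / \prod_(c <- C) ((z ^+ r.+1) ^ c - 1)).
Proof.
move=> zP; have N0 := prim_order_gt0 zP.
rewrite /fourier_dedekind; congr (_ * _).
pose g (l : R[i]) := l ^ t / \prod_(c <- C) (l ^ c - 1).
rewrite (fsbig_ord _ N.-1 (fun r => g (z ^+ r.+1))).
apply: (@reindex_fsbig _ _ _ _ _ (fun r => z ^+ r.+1) `I_N.-1 _ g).
split.
- move=> r /= rN; split.
    by rewrite exprAC (prim_expr_order zP) expr1n.
  rewrite -(prim_order_dvd zP) gtnNdvd //.
  by rewrite -(prednK N0) ltnS.
- move=> r1 r2; rewrite !inE /= => r1N r2N /eqP.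
  rewrite (eq_prim_root_expr zP) !modn_small; last 2 first.
  - by rewrite -(prednK N0) ltnS.
  - by rewrite -(prednK N0) ltnS.
  by move=> /eqP[].
- move=> l [lN l1] /=.
  have [r lE] := prim_rootP zP lN.
  have r0 : (0 < r)%N by rewrite lt0n; apply: contra l1 => /eqP r0; rewrite lE r0.
  by exists r.-1; rewrite /= ?prednK // -ltnS !prednK.
Qed.

Lemma fd_coefE n (M : 'M[int]_(2, n)) i j f g w u :
  fd_coef M i j f g w u = w * (f * det2 (col i M) u + g * det2 (col j M) u).
Proof. by rewrite /fd_coef /det2 !mxE; ring. Qed.

Lemma fd_coefD n (M : 'M[int]_(2, n)) i j f g w u v :
  fd_coef M i j f g w (u + v) = fd_coef M i j f g w u + fd_coef M i j f g w v.
Proof. by rewrite !fd_coefE !det2Dr; ring. Qed.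

(** * The cyclic quotient Z^2 / (Z m_i + Z m_j) *)

Section Inverse.
Variables (n : nat) (M : 'M[int]_(2, n)) (i j m : 'I_n) (f g w : int).
Hypothesis hw : (w * (f * minor2 M i m + g * minor2 M j m) = 1 %[mod minor2 M i j])%Z.

Lemma dvd_fd_coef_l : (minor2 M i j %| fd_coef M i j f g w (col i M))%Z.
Proof.
rewrite fd_coefE det2uu mulr0 add0r det2C -minor2E !mulrN rpredN.
by rewrite mulrA dvdz_mull.
Qed.

Lemma dvd_fd_coef_r : (minor2 M i j %| fd_coef M i j f g w (col j M))%Z.
Proof. by rewrite fd_coefE det2uu mulr0 addr0 -minor2E mulrA dvdz_mull. Qed.

(** Modulo e both w and c = f Y_im + g Y_jm are invertible, and the Plucker relation expresses c
    det2 (m_i, u) and c det2 (m_j, u) through f det2 (m_i, u) + g det2 (m_j, u) and multiples of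
    Y_ij. For e = Y_ij the kernel of [fd_coef] is the lattice Z m_i + Z m_j, which gives
    orthogonality; for other divisors e it yields coprimality from the 1-prime condition. *)
Lemma dvd_fd_coef (e : int) u : (e %| minor2 M i j)%Z ->
  (e %| fd_coef M i j f g w u)%Z ->
  (e %| det2 (col i M) u)%Z && (e %| det2 (col j M) u)%Z.
Proof.
move=> eY; rewrite fd_coefE; have hw' := hw; pose c := f * minor2 M i m + g *
  minor2 M j m; rewrite -/c in hw'.
pose A := f * det2 (col i M) u + g * det2 (col j M) u; rewrite -/A => ewA.
have e1 : (e %| w * c - 1)%Z.
  apply: (dvdz_trans eY); rewrite -eqz_mod_dvd; exact/eqP/hw'.
have cancel x : (e %| c * x)%Z -> (e %| x)%Z.
  move=> ecx; have -> : x = w * (c * x) - (w * c - 1) * x by ring.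
  by apply: rpredB; [exact: dvdz_mull|exact: dvdz_mulr].
have eA : (e %| A)%Z.
  have -> : A = c * (w * A) - (w * c - 1) * A by ring.
  by apply: rpredB; [exact: dvdz_mull|exact: dvdz_mulr].
have P := det2_plucker (col i M) (col j M) (col m M) u.
apply/andP; split; apply: cancel.
  have -> : c * det2 (col i M) u = minor2 M i m * A - g * (det2 (col m M) u * minor2 M i j).
    by rewrite /c /A !minor2E -[in X in _ = _ - X](mulrC (det2 (col i M) (col j M))) -P;
      ring.
  by apply: rpredB; rewrite !dvdz_mull.
have -> : c * det2 (col j M) u = minor2 M j m * A + f * (det2 (col m M) u * minor2 M i j).
  by rewrite /c /A !minor2E -[in X in _ = _ + X](mulrC (det2 (col i M) (col j M))) -P; ring.
by apply: rpredD; rewrite !dvdz_mull.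
Qed.

End Inverse.

Lemma one_prime_dvd (R : realType) n (M : 'M[int]_(2, n)) (i j h : 'I_n) (e : int) :
  one_prime R M -> minor2 M i j != 0 -> minor2 M i h != 0 -> minor2 M j h != 0 ->
  (e %| minor2 M i j)%Z -> (e %| minor2 M i h)%Z -> (e %| minor2 M j h)%Z ->
  `|e|%N = 1%N.
Proof.
move=> hM ij ih jh eij eih ejh.
have neq (a c : 'I_n) : minor2 M a c != 0 -> a != c.
  by apply: contra => /eqP ->; rewrite minor2E det2uu.
pose s (p : 'I_3) : 'I_n := nth i [:: i; j; h] p.
have sinj : injective s.
  move=> p q spq; apply: val_inj; apply/eqP.
  rewrite -(nth_uniq i (s := [:: i; j; h])) ?spq //= ?ltn_ord //.
    by apply/eqP; exact: spq.
  by rewrite !inE !negb_or !neq.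
have rk : \rank (map_mx intr (colsub s M) : 'M[R]_(2, 3)) = 2%N.
  apply/eqP; apply: inj_row_free => v /matrixP vM.
  have E (p : 'I_3) : v 0 0 * (M 0 (s p))%:~R + v 0 1 * (M 1 (s p))%:~R = 0.
    have := vM 0 p; rewrite !mxE !big_ord_recl big_ord0 !mxE addr0.
    by rewrite (_ : lift ord0 ord0 = 1) //; exact: val_inj.
  have E0 := E 0; have E1 := E 1; rewrite /s /= in E0 E1.
  have Y0 : ((minor2 M i j)%:~R : R) != 0 by rewrite intr_eq0.
  have v0 : v 0 0 = 0.
    apply: (mulfI Y0); rewrite mulr0 /minor2 rmorphB !rmorphM /=.
    transitivity ((M 1 j)%:~R * (v 0 0 * (M 0 i)%:~R + v 0 1 * (M 1 i)%:~R) -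
      (M 1 i)%:~R * (v 0 0 * (M 0 j)%:~R + v 0 1 * (M 1 j)%:~R)); first by ring.
    by rewrite E0 E1 !mulr0 subr0.
  have v1 : v 0 1 = 0.
    apply: (mulfI Y0); rewrite mulr0 /minor2 rmorphB !rmorphM /=.
    transitivity ((M 0 i)%:~R * (v 0 0 * (M 0 j)%:~R + v 0 1 * (M 1 j)%:~R) -
      (M 0 j)%:~R * (v 0 0 * (M 0 i)%:~R + v 0 1 * (M 1 i)%:~R)); first by ring.
    by rewrite E0 E1 !mulr0 subr0.
  apply/trmx_inj/cV2P; by rewrite !mxE.
have := hM s sinj rk => gcd1.
apply/eqP; rewrite -dvdn1 -gcd1; apply/dvdn_biggcdP => -[p q] /= /andP[pq _].
rewrite -[X in (X %| _)%N]/`|e|%N -dvdzE.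
move: pq; case: p => [[|[|[|//]]] ?]; case: q => [[|[|[|//]]] ?] //= _.
Qed.

(** * Existence of generic slopes *)

Section GenericWeights.
Variables (R : realType) (n : nat) (M : 'M[int]_(2, n)).
Hypothesis hn : (3 <= n)%N.
Hypothesis hY : forall i j : 'I_n, (i < j)%N -> 0 < minor2 M i j.

Lemma minor2_neq0 (i j : 'I_n) : i != j -> minor2 M i j != 0.
Proof.
move=> ij; have [/hY|/hY|/val_inj/eqP] := ltngtP i j; last by rewrite (negPf ij).
  by move/lt0r_neq0.
by rewrite minor2E det2C -minor2E => /lt0r_neq0; rewrite oppr_eq0.
Qed.

(* With linear forms rho and l, l > 0, the points (m_h, rho(m_h)^2 / l(m_h)) lie on
   a strictly convex cone, so no three of them are linearly dependent. *)
Lemma generic_weights : exists s : 'I_n -> R,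
  forall i j h, i != j -> h != i -> h != j -> wgap M s i j h != 0.
Proof.
have h0 : (0 < n)%N by exact: leq_trans hn.
have hl : (n.-1 < n)%N by rewrite ltn_predL.
pose i0 : 'I_n := Ordinal h0; pose il : 'I_n := Ordinal hl.
pose rho h : R := (minor2 M i0 h)%:~R.
pose l h : R := (minor2 M i0 h + minor2 M h il)%:~R.
have l0 h : l h != 0.
  rewrite intr_eq0 gt_eqF //.
  have A : 0 <= minor2 M i0 h by apply: minor2_ge0 => //.
  have B : 0 <= minor2 M h il by apply: minor2_ge0 => //=; rewrite -ltnS prednK.
  have [h00|h00] := eqVneq (nat_of_ord h) 0%N.
    have : 0 < minor2 M h il by apply: hY; rewrite h00 /= -subn1 subn_gt0 ltnW.
    by lia.
  have : 0 < minor2 M i0 h by apply: hY; rewrite /= lt0n.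
  by lia.
have D0 : ((minor2 M i0 il)%:~R : R) != 0.
  by rewrite intr_eq0 gt_eqF // hY //= -subn1 subn_gt0 ltnW.
(* l and rho are linear coordinates on the plane, so passing to them scales all minors by one
   constant. *)
have PE i j : l i * rho j - l j * rho i = (minor2 M i0 il)%:~R * (minor2 M i j)%:~R.
  rewrite /l /rho -!intrM -intrB; congr (_%:~R); rewrite !minor2E /det2; ring.
clearbody rho l.
exists (fun h => rho h ^+ 2 / l h) => i j h ij hi hj.
have Yij : ((minor2 M i j)%:~R : R) != 0 by rewrite intr_eq0 minor2_neq0.
have P0 a c : a != c -> l a * rho c - l c * rho a != 0.
  by move=> ac; rewrite PE mulf_neq0 // intr_eq0 minor2_neq0.
(* Up to the scaling, the left side is the determinant of three vectors l (1, q, q^2) with q = rho /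
   l: a Vandermonde determinant, hence a product of pairwise minors. *)
suff E : (minor2 M i j)%:~R * (minor2 M i0 il)%:~R *
  wgap M (fun h => rho h ^+ 2 / l h) i j h =
   (l i * rho j - l j * rho i) * (l j * rho h - l h * rho j) * (l h * rho i - l i * rho h)
     / (l i * l j * l h).
  apply: contraTneq isT => W0; move: E; rewrite W0 mulr0 => /esym/eqP.
  by rewrite !mulf_eq0 invr_eq0 !mulf_eq0 !(negPf (l0 _)) !(negPf (P0 _ _ _)) // eq_sym.
rewrite /wgap /wform -!minor2E.
set Yhj := (minor2 M h j)%:~R; set Yih := (minor2 M i h)%:~R.
transitivity (rho i ^+ 2 / l i * ((minor2 M i0 il)%:~R * Yhj) + rho j ^+ 2 / l j *
  ((minor2 M i0 il)%:~R * Yih) - rho h ^+ 2 / l h * ((minor2 M i0 il)%:~R *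
  (minor2 M i j)%:~R)).
  by field; rewrite Yij !l0.
rewrite /Yhj /Yih -!PE; field; by rewrite !l0.
Qed.

End GenericWeights.

#[local] Arguments cexp {R} z : simpl never.

(** * The deformed formula and its limit *)

Section Deformation.
Variables (R : realType) (n : nat) (M : 'M[int]_(2, n)).
Local Notation K := R[i].
Hypothesis hn : (3 <= n)%N.
Hypothesis hM : one_prime R M.
Hypothesis hY : forall i j : 'I_n, (i < j)%N -> 0 < minor2 M i j.
Variables (m : 'I_n -> 'I_n -> 'I_n) (f g w : 'I_n -> 'I_n -> int).
Hypothesis hw : forall i j : 'I_n, (i < j)%N ->
  (w i j * (f i j * minor2 M i (m i j) + g i j * minor2 M j (m i j))
   = 1 %[mod minor2 M i j])%Z.
Variable s : 'I_n -> R.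
Hypothesis gen : forall i j h, i != j -> h != i -> h != j -> wgap M s i j h != 0.

Local Notation Y i j := `|minor2 M i j|%N.
Local Notation fd i j u := (fd_coef M i j (f i j) (g i j) (w i j) u).

Definition root_of_order i j : K := xget 1 [set x | (Y i j).-primitive_root x].
Local Notation z := root_of_order.

Lemma root_of_orderP (i j : 'I_n) : (i < j)%N -> (Y i j).-primitive_root (z i j).
Proof.
move=> ij; have [|x xP] := @prim_root_exists K (Y i j).
  by rewrite lt0n absz_eq0 gt_eqF // hY.
exact: (@xgetPex _ 1 [set x | (Y i j).-primitive_root x] (ex_intro _ x xP)).
Qed.

Lemma root_power_neq0 (i j : 'I_n) r (c : int) : (i < j)%N -> (z i j ^+ r) ^ c != 0.
Proof.
move=> ij; rewrite expfz_neq0 // expf_neq0 //; apply/eqP => z0.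
have := root_of_orderP ij; rewrite z0 => z0P.
have := prim_expr_order z0P; rewrite expr0n gtn_eqF ?(prim_order_gt0 z0P) //.
by move/eqP; rewrite eq_sym oner_eq0.
Qed.

Lemma root_power_eq1 (i j : 'I_n) r (c : int) : (i < j)%N ->
  (minor2 M i j %| c)%Z -> (z i j ^+ r) ^ c = 1.
Proof.
move=> ij /dvdzP[q ->]; have Y0 := hY ij.
have -> : minor2 M i j = (Y i j)%:Z by rewrite gez0_abs // ltW.
rewrite mulrC -exprz_exp -exprnP exprAC (prim_expr_order (root_of_orderP ij)).
by rewrite expr1n exp1rz.
Qed.

Lemma norm_root_power (i j : 'I_n) r (c : int) : (i < j)%N -> `|(z i j ^+ r) ^ c| = 1.
Proof.
move=> ij; have zP := root_of_orderP ij; have N0 := prim_order_gt0 zP.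
have z1 : `|z i j| = 1.
  by apply/eqP; rewrite -(@pexpr_eq1 _ _ (Y i j)) // -normrX (prim_expr_order zP) normr1.
have zr : `|z i j ^+ r| = 1 by rewrite normrX z1 expr1n.
case: c => c; first by rewrite -exprnP normrX zr expr1n.
by rewrite NegzE -exprnN normfV normrX zr expr1n invr1.
Qed.

Definition weight (t : R) i : K := cexp ((t * s i)%:C%C).

(** A root of unity character trivial on m_i and m_j, times the exponential of the real form that
    takes the prescribed values there. *)
Definition character (t : R) i j r (u : 'cV[int]_2) : K :=
  (z i j ^+ r) ^ fd i j u * cexp ((t * wform M s i j u)%:C%C).

Lemma wform_add i j u v : wform M s i j (u + v) = wform M s i j u + wform M s i j v.
Proof. by rewrite /wform det2Dl det2Dr !rmorphD /= -mulrDl; congr (_ / _); ring. Qed.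

Lemma cexp_realX (x : R) c : cexp (x%:C%C : K) ^+ c = cexp ((x * c%:R)%:C%C).
Proof.
elim: c => [|c IH]; first by rewrite mulr0 cexp0.
by rewrite exprS IH -cexpD -rmorphD /= -nat1r mulrDr mulr1.
Qed.

Lemma cexp_real_inj (x y : R) : cexp (x%:C%C : K) = cexp (y%:C%C : K) -> x = y.
Proof. by rewrite !cexp_real => /complexI /expR_inj. Qed.

Let Yneq0 (i j : 'I_n) : i != j -> minor2 M i j != 0.
Proof. exact: minor2_neq0. Qed.

Let ltn_neq (i j : 'I_n) : (i < j)%N -> i != j.
Proof. by move=> ij; rewrite -val_eqE ltn_eqF. Qed.

Lemma deformed_count (t : R) (k : nat) (b : 'cV[int]_2) : 0 < t ->
  chamber M k [set: 'I_n]%SET b ->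
  wsum M (weight t) [set: 'I_n]%SET b =
  pair_sum M (weight t) (character t) k [set: 'I_n]%SET b.
Proof.
move=> t0; apply: wsum_pair_sum; rewrite ?(ltnW hn) //.
- by move=> i; exact: cexp_neq0.
- by move=> i j ij; rewrite pnatr_eq0 absz_eq0 gt_eqF // hY.
- move=> i j r u v ij; rewrite /character fd_coefD wform_add mulrDr rmorphD cexpD.
  rewrite expfzDr; last by have := root_power_neq0 r 1 ij; rewrite expr1z.
  exact: mulrACA.
- move=> i j r ij; rewrite /character root_power_eq1 ?dvd_fd_coef_l // mul1r.
  by rewrite wforml ?ltn_neq.
- move=> i j r ij; rewrite /character root_power_eq1 ?dvd_fd_coef_r // mul1r.
  by rewrite wformr ?ltn_neq.
- by move=> i j r u ij; rewrite /character mulf_neq0 ?root_power_neq0 ?cexp_neq0.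
(* Taking moduli removes the root of unity, so an equality would say [wgap] = 0. *)
- move=> i j h r ij hi hj; apply/eqP => /(congr1 Num.norm).
  rewrite /character normrM norm_root_power // mul1r /weight !cexp_real !normc_real.
  rewrite !ger0_norm ?expR_ge0 // => /complexI /expR_inj /(mulfI (lt0r_neq0 t0)) E.
  by have := gen (ltn_neq ij) hi hj; rewrite /wgap E subrr eqxx.
- move=> i j u ij ND; rewrite /character -mulr_suml.
  rewrite (sum_prim_root (root_of_orderP ij)) ?mul0r //.
  apply: contra ND => D.
  have YE : (Y i j)%:Z = minor2 M i j by rewrite gez0_abs // ltW // hY.
  rewrite YE in D; have := dvd_fd_coef (hw ij) (dvdzz _) D.
  by rewrite [in X in _ -> X]det2C rpredN andbC.
(* Taking logarithms, equality means Y_hj s_i = Y_ij s_h + Y_hi s_j, that is, w_hj(m_i) = s_i. *)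
- move=> h i j hi ij; rewrite /weight !cexp_realX -cexpD -rmorphD /=.
  apply/eqP => /cexp_real_inj E.
  have hj := ltn_trans hi ij.
  have := gen (ltn_neq hj) (_ : i != h) (_ : i != j).
  rewrite (ltn_neq ij) eq_sym (ltn_neq hi) => /(_ isT isT) /eqP; apply.
  have Yr (p q : 'I_n) : (p < q)%N -> ((Y p q)%:R : R) = (minor2 M p q)%:~R.
    by move=> pq; rewrite -[LHS]/((Y p q)%:Z%:~R) gez0_abs // ltW // hY.
  move: E; rewrite !Yr // -!mulrA -mulrDr => /(mulfI (lt0r_neq0 t0)) E.
  rewrite /wgap /wform -!minor2E -E mulfK ?subrr //.
  by rewrite intr_eq0 Yneq0 // ltn_neq.
- by apply/finset.set0Pn; exists (Ordinal (ltnW (ltnW hn))); rewrite inE.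
Qed.

Let d := (n - 2)%N.

Definition sK (i : 'I_n) : K := (s i)%:C%C.

Lemma wformC i j u : (wform M s i j u)%:C%C = wform M sK i j u.
Proof. by rewrite /wform rmorphM rmorphD !rmorphM fmorphV !rmorph_int. Qed.

Lemma wgapC i j h : (wgap M s i j h)%:C%C = wgap M sK i j h.
Proof. by rewrite /wgap rmorphB /= wformC. Qed.

Lemma character_ratio t (i j h : 'I_n) r : (i < j)%N ->
  weight t h / character t i j r (col h M) =
  (z i j ^+ r) ^ (- fd i j (col h M)) * cexp ((t * - wgap M s i j h)%:C%C).
Proof.
move=> ij; rewrite /weight /character invfM -cexpN mulrCA -cexpD invr_expz.
by rewrite -rmorphN -rmorphD /= /wgap; congr (_ * cexp (_%:C%C)); ring.
Qed.

Definition main_term t i j b : K :=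
  (Y i j)%:R^-1 * (cexp ((t * wform M s i j b)%:C%C) /
    \prod_(h < n | (h != i) && (h != j)) (1 - cexp ((t * - wgap M s i j h)%:C%C))).

Definition root_term t i j b : K :=
  (Y i j)%:R^-1 * \sum_(r < (Y i j).-1)
     ((z i j ^+ r.+1) ^ fd i j b * cexp ((t * wform M s i j b)%:C%C) /
    \prod_(h < n | (h != i) && (h != j))
      (1 - (z i j ^+ r.+1) ^ (- fd i j (col h M)) * cexp ((t * - wgap M s i j h)%:C%C))).

Lemma pair_term_split t (i j : 'I_n) b : (i < j)%N ->
  pair_term M (weight t) (character t) [set: 'I_n]%SET (i, j) b =
  main_term t i j b
  + root_term t i j b.
Proof.
move=> ij; rewrite /pair_term /main_term /root_term /=;
  have N0 := prim_order_gt0 (root_of_orderP ij).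
have sumS (N : nat) (F : nat -> K) : (0 < N)%N ->
    \sum_(r < N) F r = F 0%N + \sum_(r < N.-1) F r.+1.
  by case: N => // N _; rewrite big_ord_recl.
rewrite (sumS _ (fun r => character t i j r b /
  \prod_(h in [set: 'I_n]%SET | (h != i) && (h != j))
    (1 - weight t h / character t i j r (col h M)))) // mulrDr.
have E r : \prod_(h in [set: 'I_n]%SET | (h != i) && (h != j))
    (1 - weight t h / character t i j r (col h M)) =
  \prod_(h < n | (h != i) && (h != j))
      (1 - (z i j ^+ r) ^ (- fd i j (col h M)) * cexp ((t * - wgap M s i j h)%:C%C)).
  apply: eq_big => [h|h _]; first by rewrite inE.
  by rewrite character_ratio.
congr (_ * _ + _ * _); last by apply: eq_bigr => r _; rewrite E.
rewrite E /character expr0 exp1rz mul1r; congr (_ / _).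
by apply: eq_bigr => h _; rewrite exp1rz mul1r.
Qed.

Lemma fourier_dedekind_lim (i j : 'I_n) b : (i < j)%N ->
  (root_term t i j b : K^o)
    @[t --> 0^'+] -->
  (fourier_dedekind R (fd_t M i j (f i j) (g i j) (w i j) b)
     (fd_C M i j (f i j) (g i j) (w i j)) (Y i j) : K^o).
Proof.
move=> ij; rewrite /root_term; have zP := root_of_orderP ij; have N0 := prim_order_gt0 zP.
have YE : (Y i j)%:Z = minor2 M i j by rewrite gez0_abs // ltW // hY.
(* This is where the 1-prime condition enters: the gcd of Y_ij and the exponent of m_h divides Y_ij,
   Y_ih and Y_jh, hence is 1, and no denominator vanishes at t = 0. *)
have cop (h : 'I_n) (r : 'I_(Y i j).-1) : h != i -> h != j ->
    (z i j ^+ r.+1) ^ fd i j (col h M) != 1.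
  move=> hi hj; apply/eqP => E.
  have rN : (r.+1 < Y i j)%N by rewrite -ltn_predRL.
  have D : (Y i j %| r.+1 * `|fd i j (col h M)|)%N.
    rewrite (prim_order_dvd zP) exprM; apply/eqP.
    move: E; case: (fd i j (col h M)) => // c E.
    by apply: invr_inj; rewrite invr1; exact: E.
  have cp : coprime (Y i j) `|fd i j (col h M)|.
    rewrite /coprime; set e := gcdn _ _.
    have e1 : (e%:Z %| minor2 M i j)%Z by rewrite dvdzE dvdn_gcdl.
    have e2 : (e%:Z %| fd i j (col h M))%Z by rewrite dvdzE dvdn_gcdr.
    have /andP[e3 e4] := dvd_fd_coef (hw ij) e1 e2.
    rewrite -!minor2E in e3 e4.
    have := one_prime_dvd hM (Yneq0 (ltn_neq ij)) (Yneq0 _) (Yneq0 _) e1 e3 e4.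
    by rewrite eq_sym hi eq_sym hj => /(_ isT isT) /= ->.
  by move: D; rewrite Gauss_dvdl // gtnNdvd.
rewrite (fourier_dedekindE _ _ zP).
apply: limM; first exact: lim_cst.
apply: lim_sum => r _.
have zr0 : z i j ^+ r.+1 != 0 by have := root_power_neq0 r.+1 1 ij; rewrite expr1z.
(* 1 / (1 - x^-1) = x / (x - 1) for each h; the extra factors x collect into the summand sum_(c in
   C) c of [fd_t]. *)
have -> : (z i j ^+ r.+1) ^ fd_t M i j (f i j) (g i j) (w i j) b /
    \prod_(c <- fd_C M i j (f i j) (g i j) (w i j)) ((z i j ^+ r.+1) ^ c - 1) =
  (z i j ^+ r.+1) ^ fd i j b * 1 / \prod_(h < n | (h != i) && (h != j))
      (1 - (z i j ^+ r.+1) ^ (- fd i j (col h M)) * 1).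
  have XD (F : 'I_n -> int) : (z i j ^+ r.+1) ^ (\sum_(h < n | (h != i) && (h != j)) F h) =
      \prod_(h < n | (h != i) && (h != j)) (z i j ^+ r.+1) ^ F h.
    by apply: big_morph => // x y; exact: expfzDr.
  rewrite /fd_t expfzDr // /fd_C !big_map !big_filter !big_enum_cond /= XD.
  rewrite mulr1 -mulrA; congr (_ * _); rewrite -prodf_div -prodfV.
  apply: eq_bigr => h /andP[hi hj]; have := cop h r hi hj.
  rewrite -invr_expz; have := root_power_neq0 r.+1 (fd i j (col h M)) ij.
  move: (_ ^ _) => x x0 x1; rewrite mulr1.
  have x10 : x - 1 != 0 by rewrite subr_eq0.
  by field; rewrite x10 x0.
apply: limM.
  by apply: limM; [exact: lim_cst|exact: cvg_cexp].
apply: limV.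
  apply/prodf_neq0 => h /andP[hi hj]; rewrite mulr1 subr_eq0 eq_sym -invr_expz invr_eq1.
  exact: cop.
apply: lim_prod => h _.
by apply: limB; [exact: lim_cst|apply: limM; [exact: lim_cst|exact: cvg_cexp]].
Qed.

(** The sum is t^-(n-2) times a function with a known expansion. By [sum_pairs] the coefficients of
    degree below n - 2 vanish, and the next one is the limit, recognized through [p_eE]. *)
Lemma poly_part_lim (k : 'I_n) b :
  (\sum_(i < n) \sum_(j < n | (i <= k < j)%N)
    main_term t i j b : K^o)
    @[t --> 0^'+] --> (p_e M k (map_mx intr b : 'cV[K]_2) : K^o).
Proof.
have [td tdP] := trunc_inv d (phi_neg0 R n).
pose E : {poly K} := exp_poly R d.+1.
have expG i j : expands d (fun t => (kappa M sK i j) * (cexp ((t * wform M s i j b)%:C%C) *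
    \prod_(h < n) (phi 1 (t * - wgap M s i j h)%:C%C)^-1) : K^o)
    ((kappa M sK i j)%:P * gpoly M sK E td b i j).
  apply: expands_mul; first exact: expands_cst.
  apply: expands_mul.
    have := expands_phi d 0 (wform M s i j b); rewrite phi0 wformC.
    suff -> : phi_poly R 0 d.+1 = E by [].
    by apply/polyP => r; rewrite !coef_poly add0n.
  apply: expands_prod => h.
  have H := expands_phi d 1 (- wgap M s i j h).
  apply: (expands_inv H).
    by rewrite horner_coef0 coef_comp_scale coef_poly /= addn0 factS fact0 invr1 mul1r.
  have -> : phi_poly R 1 d.+1 \Po ((- wgap M s i j h)%:C%C *: 'X) =
    phi_neg R n \Po (wgap M sK i j h *: 'X).
    by apply/polyP => r; rewrite !coef_comp_scale rmorphN /= wgapC -mulN1r exprMn mulrA.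
  rewrite -comp_polyM (_ : 1 = 1 \Po (wgap M sK i j h *: 'X)); last by rewrite rmorph1.
  exact: eq_trunc_comp_scale.
have expS : expands d (fun t => \sum_(i < n) \sum_(j < n | (i <= k < j)%N)
     (kappa M sK i j) * (cexp ((t * wform M s i j b)%:C%C) *
    \prod_(h < n) (phi 1 (t * - wgap M s i j h)%:C%C)^-1) : K^o)
   (\sum_(i < n) \sum_(j < n | (i <= k < j)%N) (kappa M sK i j)%:P * gpoly M sK E td b i j).
  by apply: expands_sum => i _; apply: expands_sum.
have genK i j h : i != j -> h != i -> h != j -> wgap M sK i j h != 0.
  by move=> ij hi hj; rewrite -wgapC (inj_eq (@complexI R)) gen.
have coefS r : (r <= d)%N -> (\sum_(i < n) \sum_(j < n | (i <= k < j)%N) (kappa M sK i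
  j)%:P * gpoly M sK E td b i j)`_r
   = (r == d)%N%:R * p_e M k (map_mx intr b : 'cV[K]_2).
  move=> rd; rewrite coef_sum.
  under eq_bigr => i _.
    rewrite coef_sum; under eq_bigr => j _ do rewrite coefCM.
    over.
  rewrite (sum_pairs hn Yneq0 genK) //; congr (_ * _).
  rewrite (p_eE M k tdP); apply: eq_bigr => l _.
  have tE h : (M 1 l * M 0 h - M 1 h * M 0 l)%:~R = (minor2 M h l)%:~R :> K.
    by congr (_%:~R); rewrite /minor2; ring.
  congr (_ * (_ : {poly K})`_ _).
    by rewrite /kap; congr (_^-1); apply: eq_bigr => h _; rewrite tE.
  rewrite /lpoly /todd; congr (_ * _).
    congr (_ \Po (_ *: _)); rewrite /det2 !mxE rmorphB !rmorphM /=.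
    by ring.
  by apply: eq_bigr => h _; rewrite tE.
move: (coefS d (leqnn d)); rewrite eqxx mul1r => top.
have low r : (r < d)%N -> (\sum_(i < n) \sum_(j < n | (i <= k < j)%N) (kappa M sK i
  j)%:P * gpoly M sK E td b i j)`_r = 0.
  by move=> rd; rewrite coefS ?(ltnW rd) // ltn_eqF // mul0r.
have H := expands_lead low expS; rewrite top in H.
apply: (cvg_eq_near _ H).
near=> t.
have t0 : 0 < t by near: t; exact: nbhs_right_gt.
have tK : t%:C%C != 0 :> K by rewrite (inj_eq (@complexI R)) gt_eqF.
rewrite /main_term mulr_suml; apply: eq_bigr => i _; rewrite mulr_suml;
  apply: eq_bigr => j /andP[ik kj].
have ij : (i < j)%N := leq_ltn_trans ik kj.
have Yt : (Y i j)%:R = (minor2 M i j)%:~R :> K.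
  by rewrite -[LHS]/((Y i j)%:Z%:~R) gez0_abs // ltW // hY.
(* Each factor 1 - exp(-t wgap) equals t wgap phi_1(-t wgap). The product of the phi_1 may run over
   all h, since [wgap] is 0 and phi_1 is 1 at h = i and h = j. *)
have D1 : \prod_(h < n | (h != i) && (h != j)) (1 - cexp (t * - wgap M s i j h)%:C%C) =
    t%:C%C ^+ d * (\prod_(h < n | (h != i) && (h != j)) wgap M sK i j h) *
    \prod_(h < n) phi 1 (t * - wgap M s i j h)%:C%C.
  have phi10 : phi 1 (0 : K) = 1 by rewrite /phi eqxx factS fact0 invr1.
  have ji : j != i by rewrite -val_eqE /= gtn_eqF.
  rewrite [X in _ = _ * X](bigD1 i) //= [X in _ = _ * (_ * X)](bigD1 j) //=.
  have wi : wgap M s i j i = 0 by rewrite /wgap wforml ?ltn_neq // subrr.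
  have wj : wgap M s i j j = 0 by rewrite /wgap wformr ?ltn_neq // subrr.
  rewrite wi wj oppr0 mulr0 phi10 !mul1r.
  have <- : \prod_(h < n | (h != i) && (h != j)) t%:C%C = t%:C%C ^+ d :> K.
    rewrite prodr_const; congr (_ ^+ _).
    have := cardC (pred2 i j); rewrite card2 ltn_neq // card_ord => cE.
    rewrite /d -[X in (X - 2)%N]cE addKn; apply: eq_card => h.
    by rewrite !inE negb_or.
  rewrite -!big_split /=; apply: eq_bigr => h /andP[hi hj].
  have W0 : (t * - wgap M s i j h)%:C%C != 0 :> K.
    have W1 := gen (ltn_neq ij) hi hj; have t1 := lt0r_neq0 t0.
    by rewrite (inj_eq (@complexI R)) mulf_neq0 // oppr_eq0.
  have E1 : t%:C%C * wgap M sK i j h = - (t * - wgap M s i j h)%:C%C.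
    by rewrite -wgapC mulrN rmorphN opprK rmorphM.
  by rewrite E1 phiS // phi0 fact0 invr1 mulNr mulrCA mulfV // mulr1 [RHS]opprB.
rewrite D1 prodfV /kappa -Yt !invfM.
set A := cexp _; set B := (\prod_(h < n) phi _ _)^-1; set C := (\prod_(h < n | _) _)^-1.
by rewrite -!mulrA; congr (_ * _); ring.
Unshelve. all: by end_near. Qed.

End Deformation.

Lemma wsum_lim (R : realType) (n : nat) (M : 'M[int]_(2, n)) (hn : (1 < n)%N)
    (hY : forall i j : 'I_n, (i < j)%N -> 0 < minor2 M i j) (s : 'I_n -> R) b :
  (wsum M (weight s t) [set: 'I_n]%SET b : R[i]^o) @[t --> 0^'+] -->
  ((vpart M b)%:R : R[i]^o).
Proof.
have solsE : sols M [set: 'I_n]%SET b = [set x : 'cV[nat]_n | M *m map_mx Posz x = b].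
  by apply/seteqP; split => x /= => [[]|xb] //; split=> // j; rewrite inE.
(* Finiteness permits the limit term by term, and it rules out the default value of [fset_set] on
   infinite sets. *)
have fin := finite_sols hn hY [set: 'I_n]%SET b.
rewrite /vpart -solsE card_fset_sum1 natr_sum /wsum.
under eq_fun do rewrite (fsbig_finite _ _ fin).
apply: lim_sum => x _; have -> : 1%N%:R = \prod_(j < n) (1 : R[i]) by rewrite big1.
apply: lim_prod => j _; rewrite /weight.
under eq_fun do rewrite cexp_realX -mulrA.
exact: cvg_cexp.
Qed.

(** Expand the determinant along b = x m_k + y m_(k+1): both terms are nonnegative, and the one with
    the column on the far side of the chamber is positive, whereas the other may vanish. *)
Lemma open_cone_chamber (R : realType) (n : nat) (M : 'M[int]_(2, n))
    (hY : forall i j : 'I_n, (i < j)%N -> 0 < minor2 M i j)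
    (k : 'I_n) (hk : (k.+1 < n)%N) (b : 'cV[int]_2) :
  open_cone M k (Ordinal hk) (map_mx intr b : 'cV[R]_2) ->
  chamber M k [set: 'I_n]%SET b.
Proof.
case=> x [y [x0 y0 /matrixP bE]]; apply/chamberP => i _.
have b0 := bE 0 0; have b1 := bE 1 0; rewrite !mxE in b0 b1.
have E u : ((det2 u b)%:~R : R) =
    x * (det2 u (col k M))%:~R + y * (det2 u (col (Ordinal hk) M))%:~R.
  by rewrite /det2 !mxE !rmorphB !rmorphM /= b0 b1; ring.
have E' u : ((det2 b u)%:~R : R) =
    x * (det2 (col k M) u)%:~R + y * (det2 (col (Ordinal hk) M) u)%:~R.
  by rewrite det2C rmorphN /= E (det2C u (col k M)) (det2C u (col _ M)) !rmorphN /=; ring.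
have Y_ge0 (p q : 'I_n) : (p <= q)%N -> 0 <= ((minor2 M p q)%:~R : R).
  rewrite leq_eqVlt => /orP[/eqP/val_inj -> | /hY]; last by rewrite ler0z => /ltW.
  by rewrite minor2E det2uu.
have Y_gt0 (p q : 'I_n) : (p < q)%N -> 0 < ((minor2 M p q)%:~R : R).
  by move=> /hY; rewrite ltr0z.
case: ifP => ik.
  rewrite -(ltr0z R) E -!minor2E ltr_wpDl //.
    by rewrite mulr_ge0 ?Y_ge0 // ltW.
  by rewrite mulr_gt0 // Y_gt0 //= ltnS.
have ki : (k < i)%N by rewrite ltnNge ik.
rewrite -(ltr0z R) E' -!minor2E.
rewrite ltr_wpDr ?mulr_gt0 ?Y_gt0 //.
by rewrite mulr_ge0 ?Y_ge0 // ltW.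
Qed.

Unset Implicit Arguments.
Set Strict Implicit.

Theorem theorem11 (R : realType) (n : nat) (hn : (3 <= n)%N)
    (M : 'M[int]_(2, n)) (hM : one_prime R M)
    (hY : forall i j : 'I_n, (i < j)%N -> 0 < minor2 M i j)
    (k : 'I_n) (hk : (k.+1 < n)%N)
    (b : 'cV[int]_2)
    (hb : open_cone M k (Ordinal hk) (map_mx intr b : 'cV[R]_2))
    (m : 'I_n -> 'I_n -> 'I_n) (f g w : 'I_n -> 'I_n -> int)
    (hm : forall i j : 'I_n, (i < j)%N -> m i j != i /\ m i j != j)
    (hfg : forall i j : 'I_n, (i < j)%N ->
       gcdz (f i j * minor2 M i (m i j) + g i j * minor2 M j (m i j))
            (minor2 M i j) = 1)
    (hw : forall i j : 'I_n, (i < j)%N ->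
       (w i j * (f i j * minor2 M i (m i j) + g i j * minor2 M j (m i j))
        = 1 %[mod minor2 M i j])%Z) :
  (vpart M b)%:R =
    p_e M k (map_mx intr b : 'cV[R[i]]_2) +
    \sum_(i < n) \sum_(j < n | (i <= k < j)%N)
      fourier_dedekind R (fd_t M i j (f i j) (g i j) (w i j) b)
                         (fd_C M i j (f i j) (g i j) (w i j))
                         `|minor2 M i j|%N.
Proof.
have [s gen] := generic_weights R hn hY.
have Cb := open_cone_chamber hY hb.
have Lpoly := @poly_part_lim _ _ _ hn hY _ gen k b.
have Lfd : (\sum_(i < n) \sum_(j < n | (i <= k < j)%N)
      root_term M f g w s t i j b : R[i]^o) @[t --> (0 : R)^'+] -->
    (\sum_(i < n) \sum_(j < n | (i <= k < j)%N)
      fourier_dedekind R (fd_t M i j (f i j) (g i j) (w i j) b)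
        (fd_C M i j (f i j) (g i j) (w i j)) `|minor2 M i j|%N : R[i]^o).
  apply: lim_sum => i _; apply: lim_sum => j /andP[ik kj].
  by apply: (fourier_dedekind_lim hM hY hw); exact: leq_ltn_trans kj.
have W := @wsum_lim _ _ _ (ltnW hn) hY s b.
(* The deformed count has two limits as t tends to 0, the vector partition function and the
   right-hand side; they agree because the space is Hausdorff. *)
apply: (@cvg_unique _ (@norm_hausdorff _ R[i]^o) _ _ _ _ W).
apply: (cvg_eq_near _ (limD Lpoly Lfd)); near=> t.
have t0 : 0 < t by near: t; exact: nbhs_right_gt.
rewrite (deformed_count hn hY hw gen t0 Cb) /pair_sum -big_split /=.
rewrite (eq_bigr (fun i : 'I_n => \sum_(j < n | (i <= k < j)%N)
  pair_term M (weight s t) (character M f g w s t) [set: 'I_n]%SET (i, j) b)); last first.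
  move=> i _; rewrite -big_split /=; apply: eq_bigr => j /andP[ik kj].
  by rewrite (pair_term_split hY) // (leq_ltn_trans ik).
rewrite pair_big_dep /=; apply: eq_big => [[i j]|[i j] _] //=.
by rewrite !inE.
Unshelve. all: by end_near. Qed.
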